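(* The Lipschitz dimension of any QC tree is equal to $1$.
   Context: A metric space is doubling if there is $D\ge1$ such that every ball of radius $r>0$ can be covered by at most $D$ balls of radius $r/2$. It is bounded turning if there is $B\ge1$ such that every pair of points $u,v$ is contained in a compact connected set $E$ with $\operatorname{diam}(E)\le B\,d(u,v)$. A metric tree is a compact, connected, locally connected metric space such that each pair of distinct points forms the endpoints of a unique Jordan arc (homeomorphic image of $[0,1]$). A QC tree is a metric tree (with more than one point) that is both doubling and bounded turning. For $\delta>0$, a finite sequence $(u_i)$ is a $\delta$-chain if $d(u_i,u_{i+1})\le\delta$ for all consecutive indices. A set $U$ is $\delta$-connected if every pair of points of $U$ is contained in a $\delta$-chain in $U$; a $\delta$-component of a set is a maximal $\delta$-connected subset. A map $f:X\to Y$ between metric spaces is Lipschitz light if there are $L,Q>0$ such that $f$ is $L$-Lipschitz and for every $r>0$ and $E\subset Y$ with $\operatorname{diam}(E)\le r$, the $r$-components of $f^{-1}(E)$ have diameter at most $Qr$. A metric space $X$ has Lipschitz dimension at most $n$ if there exists a Lipschitz light map $X\to\mathbb{R}^n$; the Lipschitz dimension is the least such $n\geq 0$. *)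

(* Defs.v *)
From HB Require Import structures.
From mathcomp Require Import all_boot all_order all_algebra.
From mathcomp Require Import ring lra.
From mathcomp Require Import all_classical all_reals all_analysis.
Set Implicit Arguments.
Unset Strict Implicit.
Unset Printing Implicit Defensive.
Import Order.TTheory GRing.Theory Num.Theory.
Import numFieldNormedType.Exports.
Local Open Scope classical_set_scope.
Local Open Scope ring_scope.

(* R^n with the Euclidean distance. This is an alias of 'rV[R]_n because the
   library equips 'rV[R]_n itself with the sup norm. *)
Definition euclidean (R : realType) (n : nat) : Type := 'rV[R]_n.

HB.instance Definition _ (R : realType) (n : nat) :=
  Choice.copy (euclidean R n) 'rV[R]_n.

Section EuclideanMetric.
Context {R : realType} {n : nat}.
Implicit Types x y z : 'rV[R]_n.

Definition euclid_dist x y : R := Num.sqrt (\sum_(i < n) (x 0 i - y 0 i) ^+ 2).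

Let sumsq_ge0 (a : 'I_n -> R) : 0 <= \sum_i a i ^+ 2.
Proof. by apply: sumr_ge0 => i _; exact: sqr_ge0. Qed.

Lemma cauchy_schwarz (a b : 'I_n -> R) :
  \sum_i a i * b i <=
    Num.sqrt (\sum_i a i ^+ 2) * Num.sqrt (\sum_i b i ^+ 2).
Proof.
set A := \sum_i a i ^+ 2; set B := \sum_i b i ^+ 2.
have A0 : 0 <= A by exact: sumsq_ge0.
have B0 : 0 <= B by exact: sumsq_ge0.
rewrite -sqrtrM//; apply: (le_trans (ler_norm _)).
rewrite -sqrtr_sqr ler_sqrt ?mulr_ge0//.
set C := \sum_i a i * b i.
have key t : 0 <= A - C * t *+ 2 + B * t ^+ 2.
  have -> : A - C * t *+ 2 + B * t ^+ 2 = \sum_i (a i - b i * t) ^+ 2.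
    rewrite /A /B /C !mulr_suml -sumrMnl -sumrB -big_split/=.
    by apply: eq_bigr => i _; ring.
  exact: sumsq_ge0.
have [B1|] := ltP 0 B.
  have := key (C / B); rewrite -(pmulr_rge0 _ B1).
  have -> : B * (A - C * (C / B) *+ 2 + B * (C / B) ^+ 2) = A * B - C ^+ 2.
    have : B != 0 by rewrite gt_eqF.
    by move=> ?; field.
  by rewrite subr_ge0.
move=> B1; have {B0 B1} B0 : B = 0 by apply/eqP; rewrite eq_le B0 B1.
have [->|C0] := eqVneq C 0; first by rewrite expr0n/= B0 mulr0.
have := key ((A + 1) / C); rewrite B0 mul0r addr0 mulrCA divff// mulr1.
lra.
Qed.

Lemma euclid_distxx x : euclid_dist x x = 0.
Proof.
rewrite /euclid_dist big1 ?sqrtr0// => i _.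
by rewrite subrr expr0n.
Qed.

Lemma euclid_dist_positivity x y : euclid_dist x y = 0 -> x = y.
Proof.
move=> /eqP; rewrite sqrtr_eq0 => s0.
have /eqP : \sum_(i < n) (x 0 i - y 0 i) ^+ 2 = 0.
  by apply/eqP; rewrite eq_le s0 sumsq_ge0.
rewrite psumr_eq0 => [/allP h|i _]; last exact: sqr_ge0.
apply/rowP => i; have := h i (mem_index_enum i).
by rewrite /= sqrf_eq0 subr_eq0 => /eqP.
Qed.

Lemma euclid_dist_sym x y : euclid_dist x y = euclid_dist y x.
Proof.
by congr Num.sqrt; apply: eq_bigr => i _; rewrite -sqrrN opprB.
Qed.

Lemma euclid_dist_triangle y x z : euclid_dist x z <= euclid_dist x y + euclid_dist y z.
Proof.
pose a i := x 0 i - y 0 i; pose b i := y 0 i - z 0 i.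
have ab0 : 0 <= euclid_dist x y + euclid_dist y z by rewrite addr_ge0 ?sqrtr_ge0.
rewrite -(ger0_norm ab0) -sqrtr_sqr ler_sqrt ?sqr_ge0// sqrrD.
rewrite !sqr_sqrtr ?sumsq_ge0//.
have -> : \sum_(i < n) (x 0 i - z 0 i) ^+ 2 =
    \sum_i a i ^+ 2 + (\sum_i a i * b i) *+ 2 + \sum_i b i ^+ 2.
  rewrite -sumrMnl -!big_split/=; apply: eq_bigr => i _.
  by rewrite -sqrrD /a /b addrA subrK.
by rewrite lerD2r lerD2l lerMn2r cauchy_schwarz orbT.
Qed.

HB.instance Definition _ := @isMetric.Build R (euclidean R n) euclid_dist
  euclid_distxx euclid_dist_positivity euclid_dist_sym euclid_dist_triangle.

End EuclideanMetric.

Section Metric.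
Context {R : realType} {X : metricType R}.
Implicit Types (A C E U : set X) (x y u v : X) (d : R).

(* diam set0 = -oo; only upper bounds of diameters by nonnegative reals occur
   below, so this agrees there with the convention diam set0 = 0. *)
Definition diam A : \bar R :=
  ereal_sup [set (mdist p.1 p.2)%:E | p in A `*` A].

Definition delta_chain d (s : seq X) : bool :=
  sorted (fun x y => mdist x y <= d) s.

Definition delta_connected d U : Prop :=
  forall x y, U x -> U y ->
    exists s : seq X, [/\ delta_chain d s, [set` s] `<=` U, x \in s & y \in s].

Definition delta_component d A C : Prop :=
  [/\ C `<=` A, delta_connected d C &
      forall U, U `<=` A -> delta_connected d U -> C `<=` U -> U = C].

Definition jordan_arc u v A : Prop :=
  exists (f : R -> X) (g : X -> R),
    [/\ {within `[0, 1], continuous f} /\ {within A, continuous g},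
        set_bij `[0, 1] A f,
        {in `[0, 1], cancel f g},
        f 0 = u & f 1 = v].

End Metric.

Section Spaces.
Context {R : realType}.
Variable X : metricType R.

Definition doubling : Prop :=
  exists2 D : nat, (1 <= D)%N &
    forall (x : X) (r : R), 0 < r ->
      exists2 s : seq X, (size s <= D)%N &
        ball x r `<=` \bigcup_(c in [set` s]) ball c (r / 2).

Definition bounded_turning : Prop :=
  exists2 B : R, 1 <= B &
    forall u v : X, exists E : set X,
      [/\ compact E, connected E, E u, E v &
          (diam E <= (B * mdist u v)%:E)%E].

Definition locally_connected : Prop :=
  forall (x : X) (U : set X), nbhs x U ->
    exists V : set X, [/\ open V, connected V, V x & V `<=` U].

Definition metric_tree : Prop :=
  [/\ compact [set: X], connected [set: X], locally_connected &
      forall u v : X, u <> v -> exists! A : set X, jordan_arc u v A].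

Definition qc_tree : Prop :=
  [/\ metric_tree, exists u v : X, u <> v, doubling & bounded_turning].

End Spaces.

Definition lipschitz_light (R : realType) (X Y : metricType R) (f : X -> Y) :=
  exists L Q : R,
    [/\ 0 < L, 0 < Q,
        forall x y : X, mdist (f x) (f y) <= L * mdist x y &
        forall (r : R) (E : set Y), 0 < r -> (diam E <= r%:E)%E ->
          forall C : set X, delta_component r (f @^-1` E) C ->
            (diam C <= (Q * r)%:E)%E].

Definition lipschitz_dim_le (R : realType) (X : metricType R) (n : nat) :=
  exists f : X -> euclidean R n, lipschitz_light f.

(* The Lipschitz dimension of X is n; it need not exist, i.e. it may be
   infinite. *)
Definition lipschitz_dim_eq (R : realType) (X : metricType R) (n : nat) :=
  lipschitz_dim_le X n /\ forall m, lipschitz_dim_le X m -> (n <= m)%N.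

(* Main.v *)
Require Import Defs.
From mathcomp Require Import all_boot all_order all_algebra.
From mathcomp Require Import all_classical all_reals all_analysis.
From mathcomp Require Import ring lra zify.

(** A map to a point is never Lipschitz light on a connected space with two
    points: the whole space is one r-component for every r > 0. So the
    dimension is not 0, and the work is to find a Lipschitz light map to the
    line.

    Write [seg x y] for the arc between x and y and [rho x y] for its diameter.
    A Lipschitz function f on X with values in the line is Lipschitz light as
    soon as it oscillates by at least a fixed multiple of d(x, y) on [seg x y],
    for all x and y ([oscillating_light]). Indeed, let an r-chain from x to y
    have its f-values in a set of diameter r. The arcs between consecutive
    points of the chain cover [seg x y] and have diameter O(r), so f varies by
    O(r) on [seg x y], and d(x, y) = O(r).

    Arcs. Bounded turning and doubling together join any two points a, b by a
    chain with a bounded number of points and steps at most d(a, b) / 2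
    ([refinement]). Repeating this in every step yields a path from a to b of
    diameter O(d(a, b)) ([short_path]). Any path from a to b contains an arc
    from a to b ([arc_in_path]): erase a maximal family of loops, then
    parametrize what is left by a function that increases strictly along it.
    As arcs are unique, every path from a to b covers [seg a b]
    ([path_covers_seg]). This makes X behave like a combinatorial tree: the
    third side of a triangle of arcs lies in the two others ([seg_tri]), three
    points have a median ([meet_exists]), and rho <= C d ([rho_le_mdist]).

    The oscillating function. Fix a root o and a mesh h. Mark vertices along
    each ray [seg o x], each vertex being the first point at distance h from
    the one before. A function is defined on the vertices of a ray by a
    controller that reads them one after the other ([control]). As it only uses
    the past, the rays to two points receive the same values on their common
    part, and a function of x results ([zigzag]).

    The controller groups vertices into m-steps of diameter about 8^m h, for
    all m, so that each (m+1)-step is a union of m-steps. Each step goes up or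
    down. The invariant ([tracking]) is that f moves, on an upward m-step that
    starts at u, at least as fast as rho(u, .), and exceeds it by at most
    8^m h; downward steps are symmetric. An (m+1)-step going up keeps this
    promise by sending its m-steps up, except when f is so far above the lower
    bound that one m-step downward cannot violate it; then it sends the next
    m-step down. Every arc of diameter at least 5 8^m h on a ray contains a
    whole m-step, so the lower bound makes f oscillate. Every arc of diameter
    less than 8^m h on a ray meets at most two m-steps, so the upper bound
    makes f Lipschitz. The constants do not depend on h, and an ultrafilter
    limit as h tends to 0 is the required function ([oscillating_function]). *)

Set Implicit Arguments.
Unset Strict Implicit.
Unset Printing Implicit Defensive.
Import Order.TTheory GRing.Theory Num.Theory.
Import numFieldNormedType.Exports.
Local Open Scope classical_set_scope.
Local Open Scope ring_scope.

(** * Chains in doubling spaces of bounded turning *)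

Section MetricFacts.
Context {R : realType} {X : metricType R}.
Implicit Types (x y z : X) (E : set X).

Lemma continuous_mdistP (f : R -> X) : continuous f <->
  forall t e, 0 < e ->
    exists2 d, 0 < d & forall s, `|t - s| < d -> mdist (f t) (f s) < e.
Proof.
split=> [cf t e e0|H t].
  have /cvg_ballP/(_ _ e0) := cf t.
  by move=> /nbhs_ballP[d /= d0 H]; exists d => // s /H; rewrite ballEmdist.
apply/cvg_ballP => e e0; have [d d0 {}H] := H t e e0.
apply/nbhs_ballP; exists d => //= s /H.
by rewrite ballEmdist.
Qed.

Lemma metric_ball_open x (d : R) : open (ball x d).
Proof.
rewrite openE => y; rewrite ballEmdist /= => xy.
apply/nbhs_ballP; exists (d - mdist x y) => /=; first by rewrite subr_gt0.
move=> z; rewrite ballEmdist /= ltrBrDl.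
exact: le_lt_trans (metric_triangle _ _ _).
Qed.

(** Completeness with an explicit rate: any cluster point is within e k of u k. *)
Lemma compact_cauchy_limit (u : nat -> X) (e : nat -> R) :
  compact [set: X] ->
  (forall k j, (k <= j)%N -> mdist (u k) (u j) <= e k) ->
  exists q, forall k, mdist (u k) q <= e k.
Proof.
move=> cX ue; have [q [_ clq]] := cX (u @ \oo) _ filterT.
exists q => k; rewrite leNgt; apply/negP => ekq.
have /clq - /(_ (ball q (mdist (u k) q - e k))) :
    (u @ \oo) [set x | exists2 j, (k <= j)%N & x = u j].
  by exists k => // j /= kj; exists j.
case; first by apply: nbhsx_ballx; rewrite subr_gt0.
move=> _ [[j kj ->]]; rewrite ballEmdist/= metric_sym ltrBrDr => H.
have := metric_triangle (u k) (u j) q; have := ue _ _ kj; lra.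
Qed.

Definition close (d : R) : rel X := fun x y => mdist x y <= d.

(** The points of E that a d-chain in E reaches from x form a relatively open
    and closed subset of E. *)
Lemma connected_chain E d : connected E -> 0 < d ->
  forall x y, E x -> E y ->
  exists s, [/\ path (close d) x s, last x s = y & [set` s] `<=` E].
Proof.
move=> cE d0 x y Ex Ey.
pose B := [set z | E z /\
  exists s, [/\ path (close d) x s, last x s = z & [set` s] `<=` E]].
suff EB : E = B by move: Ey; rewrite {1}EB => -[].
have closeB z w : B z -> E w -> mdist z w <= d -> B w.
  move=> [Ez [s [ps sz sE]]] Ew zw; split=> //; exists (rcons s w).
  rewrite rcons_path last_rcons ps sz; split=> //.
  by move=> v /=; rewrite mem_rcons in_cons => /orP[/eqP -> //|/sE].
symmetry; apply: cE.
- by exists x; split=> //; exists [::]; split.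
- exists (\bigcup_(z in B) ball z d).
    by apply: bigcup_open => z _; exact: metric_ball_open.
  apply/seteqP; split => [w Bw|w [Ew [z Bz]]].
    by split; [exact: Bw.1|exists w => //; exact: ballxx].
  by rewrite ballEmdist => /= zw; apply: closeB Bz Ew _; exact: ltW.
- exists (~` \bigcup_(z in E `\` B) ball z d).
    by apply: open_closedC; apply: bigcup_open => z _; exact: metric_ball_open.
  apply/seteqP; split => [w Bw|w [Ew nw]].
    split; first exact: Bw.1.
    move=> [z [Ez nBz]]; rewrite ballEmdist /= metric_sym => zw; apply: nBz.
    by apply: closeB Bw Ez _; exact: ltW.
  by apply: contrapT => nBw; apply: nw; exists w => //; by rewrite ballEmdist /= mdistxx.
Qed.

Lemma connected_delta E d : connected E -> 0 < d -> delta_connected d E.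
Proof.
move=> cE d0 x y Ex Ey; have [s [ps sy sE]] := connected_chain cE d0 Ex Ey.
exists (x :: s); split=> //=.
- by move=> z /=; rewrite in_cons => /orP[/eqP->|/sE].
- by rewrite mem_head.
- by rewrite -sy mem_last.
Qed.

Lemma doubling_iter (D : nat) :
  (forall (x : X) r, 0 < r -> exists2 s : seq X, (size s <= D)%N &
     ball x r `<=` \bigcup_(c in [set` s]) ball c (r / 2)) ->
  forall j x r, 0 < r -> exists2 s : seq X, (size s <= D ^ j)%N &
     ball x r `<=` \bigcup_(c in [set` s]) ball c (r / 2 ^+ j).
Proof.
move=> dX; elim=> [|j IH] x r r0.
  by exists [:: x] => // y; exists x; rewrite /= ?inE// expr0 divr1.
have [s sD cs] := dX x r r0.
have /choice[g gP] c : exists t : seq X, (size t <= D ^ j)%N /\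
    ball c (r / 2) `<=` \bigcup_(c' in [set` t]) ball c' (r / 2 / 2 ^+ j).
  by have [|t ? ?] := IH c (r / 2); [rewrite divr_gt0|exists t].
exists (flatten (map g s)).
  rewrite size_flatten /shape -map_comp sumnE big_map expnS.
  apply: leq_trans (leq_mul sD (leqnn _)).
  elim: s {sD cs} => [|c s IHs]; first by rewrite big_nil.
  by rewrite big_cons mulSn leq_add// (gP c).1.
move=> y /cs[c /= cins /(gP c).2[c' /= c'in yc']].
exists c'; last by rewrite exprS invfM mulrA.
by apply/flattenP; exists (g c) => //; exact: map_f.
Qed.

(** A chain in the continuum E given by bounded turning may be long. Cover E by
    boundedly many balls of radius d(a, b) / 8, record which balls the chain
    visits, and cut the loops in that sequence of balls: it then visits each
    ball at most once, and the centres form the required chain. The chain is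
    extended by the constant b after its end, so N is the same for all a, b. *)
Lemma refinement : doubling X -> bounded_turning X ->
  exists N C : nat, (0 < N)%N /\ forall a b : X, exists p : nat -> X,
  [/\ p 0%N = a, p N = b,
      forall i, mdist (p i) (p i.+1) <= mdist a b / 2 &
      forall i, mdist a (p i) <= C%:R * mdist a b].
Proof.
move=> [D _ /doubling_iter dX] [B B1 bX].
(* E lies in the ball of radius 2 B r about a; after j halvings the radius is
   at most r / 8. *)
have [j jB] : exists j, 16 * B <= 2 ^+ j.
  exists (Num.bound (16 * B)); have : 0 <= 16 * B by lra.
  move=> /archi_boundP/ltW/le_trans; apply.
  by rewrite -natrX ler_nat ltnW// ltn_expl.
exists (D ^ j).+2, (Num.bound (2 * B)); split=> // a b.
have [->|ab] := eqVneq a b.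
  by exists (fun=> b); rewrite mdistxx; split=> // i; lra.
have r0 : 0 < mdist a b by rewrite mdist_gt0.
set r := mdist a b in r0 *.
have [E [_ conE Ea Eb dE]] := bX a b.
have dEr x y : E x -> E y -> mdist x y <= B * r.
  move=> Ex Ey; rewrite -lee_fin; apply: le_trans dE.
  by apply: ereal_sup_ubound; exists (x, y).
have [s0 s0D cs0] := dX j a (2 * B * r) ltac:(by rewrite !mulr_gt0//; lra).
set rad := 2 * B * r / 2 ^+ j in cs0.
have rad0 : 0 < rad by rewrite /rad divr_gt0 ?exprn_gt0 ?mulr_gt0//; lra.
have rad8 : rad <= r / 8.
  rewrite /rad ler_pdivrMr ?exprn_gt0//.
  have := ler_wpM2l (ltW r0) jB; lra.
(* Only centres of balls that meet E are near a. *)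
pose s := [seq c <- s0 | `[< exists2 x, E x & ball c rad x >]].
have sD : (size s <= D ^ j)%N.
  by apply: leq_trans s0D; rewrite size_filter count_size.
have cs x : E x -> exists2 i : 'I_(size s), true & mdist (nth a s i) x < rad.
  move=> Ex; have [|c /= cs0' cx] := cs0 x.
    rewrite ballEmdist /=; apply: le_lt_trans (dEr _ _ Ea Ex) _.
    by have := mulr_gt0 (lt_le_trans ltr01 B1) r0; rewrite -mulrA; lra.
  have cins : c \in s by rewrite mem_filter cs0' andbT; apply/asboolP; exists x.
  have cind : (index c s < size s)%N by rewrite index_mem.
  by exists (Ordinal cind) => //=; rewrite nth_index//; move: cx; rewrite ballEmdist.
have sE i : (i < size s)%N -> exists2 x, E x & mdist (nth a s i) x < rad.
  move=> /(mem_nth a); rewrite mem_filter => /andP[/asboolP[x Ex]].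
  by rewrite ballEmdist => /= cx _; exists x.
pose e : rel 'I_(size s) := fun i i' => close (r / 2) (nth a s i) (nth a s i').
have chain x t : E x -> path (close (r / 8)) x t -> [set` t] `<=` E ->
    forall i i' : 'I_(size s), mdist (nth a s i) x < rad ->
    mdist (nth a s i') (last x t) < rad -> connect e i i'.
  elim: t x => [|y t IH] x Ex /=.
    move=> _ _ i i' ix i'x; apply: connect1; rewrite /e /close.
    by have := metric_triangle (nth a s i) x (nth a s i'); rewrite (metric_sym x); lra.
  move=> /andP[xy pt] tE i i' ix i'x.
  have Ey : E y by apply: tE; rewrite /= mem_head.
  have [i'' _ iy] := cs y Ey.
  apply: (@connect_trans _ _ i''); last first.
    by apply: (IH y) => // z zt; apply: tE; rewrite /= in_cons zt orbT.
  apply: connect1; rewrite /e; move: xy; rewrite /close => xy.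
  have := metric_triangle (nth a s i) x (nth a s i'').
  by have := metric_triangle x y (nth a s i''); rewrite (metric_sym y); lra.
have [t [pt ltb tE]] := connected_chain conE (d := r / 8) ltac:(lra) Ea Eb.
have [i _ ia] := cs a Ea; have [i' _ i'b] := cs b Eb.
have /connectP[q0 pq0 lq0] : connect e i i'.
  by apply: chain pt tE _ _ ia _; rewrite ?ltb.
case/shortenP: pq0 lq0 => q pq uq _ lq.
have sq : (size (i :: q) <= size s)%N.
  by rewrite -(card_uniqP uq) (leq_trans (max_card _))// card_ord.
pose l := rcons [seq nth a s (val k) | k <- i :: q] b.
have pq' : path (close (r / 2)) (nth a s i) [seq nth a s (val k) | k <- q].
  elim: (q) (i) pq => //= k q1 IHq k' /andP[ek pq1].
  by apply/andP; split; [exact: ek|exact: IHq].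
have lq' : last (nth a s i) [seq nth a s (val k) | k <- q] = nth a s i'.
  by rewrite lq; elim: (q) (i) => //=.
have pl : path (close (r / 2)) a l.
  rewrite /l rcons_path /= pq' andbT lq' /close (metric_sym a).
  by apply/andP; split; lra.
have sl : (size l <= (D ^ j).+1)%N.
  by rewrite /l size_rcons size_map ltnS (leq_trans sq).
have ll : last a l = b by rewrite last_rcons.
have tail k : (size l <= k)%N -> nth b (a :: l) k = b.
  rewrite leq_eqVlt => /predU1P[<-|lk]; first by rewrite -last_nth.
  by rewrite nth_default.
have lB c : c \in l -> mdist a c <= 2 * B * r.
  rewrite mem_rcons in_cons => /orP[/eqP ->|/mapP[k _ ->]].
    by rewrite -/r -[leLHS]mul1r ler_pM2r//; lra.
  have [x Ex kx] := sE _ (ltn_ord k).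
  have := metric_triangle a x (nth a s k); have := dEr _ _ Ea Ex.
  rewrite (metric_sym x).
  have : r <= B * r by rewrite -[leLHS]mul1r ler_pM2r//.
  lra.
exists (nth b (a :: l)); split=> //.
- by apply: tail; exact: leq_trans sl _.
- move=> k; have [kl|lk] := ltnP k (size l).
    by have /pathP - /(_ b k kl) := pl.
  by rewrite !tail ?mdistxx ?(leq_trans lk)// divr_ge0// ltW.
- move=> k; apply: (@le_trans _ _ (2 * B * r)); last first.
    by rewrite ler_pM2r// ltW// archi_boundP//; lra.
  have [kl|lk] := leqP k (size l); last first.
    by rewrite tail ?(ltnW lk)// lB// mem_rcons mem_head.
  have : nth b (a :: l) k \in a :: l by rewrite mem_nth.
  rewrite in_cons => /orP[/eqP ->|/lB//].
  by rewrite mdistxx !mulr_ge0//; lra.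
Qed.

End MetricFacts.

(** * Short paths *)

Section ShortPaths.
Context {R : realType}.

(** Retraction of the line onto [0, 1]: precomposing with it extends a path on
    the unit interval to the whole line, where continuity is unrestricted. *)
Definition clamp (t : R) : R := Num.min 1 (Num.max 0 t).

Lemma clamp_itv t : 0 <= clamp t <= 1.
Proof.
by rewrite /clamp le_min ler01 le_max lexx/= ge_min lexx.
Qed.

Lemma clamp_id t : 0 <= t <= 1 -> clamp t = t.
Proof. by move=> /andP[t0 t1]; rewrite /clamp max_r// min_r. Qed.

Lemma clamp_lipschitz s t : `|clamp s - clamp t| <= `|s - t|.
Proof.
rewrite ler_norml; have /andP[] : - `|s - t| <= s - t <= `|s - t| by rewrite -ler_norml.
have := normr_ge0 (s - t); rewrite /clamp.
by case: (leP 0 s); case: (leP 0 t); case: (leP 1 s); case: (leP 1 t);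
  case: (leP (1 : R) 0) => *; apply/andP; split; lra.
Qed.

Lemma truncn_near (x y : R) : 0 <= x -> 0 <= y -> `|x - y| < 1 ->
  (Num.truncn x <= (Num.truncn y).+1)%N.
Proof.
move=> x0 y0; rewrite ltr_norml => /andP[_ xy].
rewrite -ltnS truncn_lt_nat//; have /andP[_ ] := truncn_itv y0.
by rewrite -[in X in _ -> X]natr1; lra.
Qed.

Lemma truncn_divn (x : R) N : 0 <= x -> (0 < N)%N ->
  (Num.truncn (x * N%:R) %/ N)%N = Num.truncn x.
Proof.
move=> x0 N0; apply/esym/truncn_def; have N0' : 0 < N%:R :> R by rewrite ltr0n.
have /andP[l u] : (Num.truncn (x * N%:R))%:R <= x * N%:R <
  (Num.truncn (x * N%:R)).+1%:R by rewrite truncn_itv// mulr_ge0.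
rewrite -(ler_pM2r N0') -(ltr_pM2r N0') -!natrM; apply/andP; split.
  by apply: le_trans l; rewrite ler_nat leq_trunc_div.
apply: (lt_le_trans u); rewrite ler_nat.
by rewrite ltn_ceil.
Qed.

Context {X : metricType R}.

Section Subdivide.
Variables (ref : X -> X -> nat -> X) (N C : nat) (a b : X).
Hypothesis N0 : (0 < N)%N.
Hypothesis ref0 : forall x y, ref x y 0%N = x.
Hypothesis refN : forall x y, ref x y N = y.
Hypothesis ref_step : forall x y i,
  mdist (ref x y i) (ref x y i.+1) <= mdist x y / 2.
Hypothesis ref_near : forall x y i, mdist x (ref x y i) <= C%:R * mdist x y.
Hypothesis cX : compact [set: X].

(** Each step of the k-th chain is replaced by N steps of half its length, so
    index i at level k stands for the time i / N ^ k. *)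
Fixpoint subdivide k i : X :=
  if k is k.+1 then ref (subdivide k (i %/ N)%N) (subdivide k (i %/ N)%N.+1) (i %% N)%N
  else if i is 0%N then a else b.

Let r := mdist a b.

Lemma subdivide0 k : subdivide k 0%N = a.
Proof. by elim: k => //= k IH; rewrite div0n mod0n ref0. Qed.

Lemma subdivide_last k : subdivide k (N ^ k) = b.
Proof. by elim: k => //= k IH; rewrite expnSr mulnK// modnMl ref0. Qed.

Lemma subdivide_step k i :
  mdist (subdivide k i) (subdivide k i.+1) <= r / 2 ^+ k.
Proof.
elim: k i => [|k IH] i.
  by rewrite expr0 divr1; case: i => //= i; rewrite mdistxx mdist_ge0.
rewrite exprSr invfM mulrA.
apply: (@le_trans _ _ (mdist (subdivide k (i %/ N)) (subdivide k (i %/ N).+1) / 2)).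
  2: by rewrite ler_pM2r// IH.
rewrite /=; have iN := ltn_pmod i N0.
have [lt|] := ltnP (i %% N).+1 N.
  have -> : (i.+1 %/ N = i %/ N)%N.
    by rewrite {1}(divn_eq i N) -addnS divnMDl// (divn_small lt) addn0.
  have -> : (i.+1 %% N = (i %% N).+1)%N.
    by rewrite {1}(divn_eq i N) -addnS modnMDl (modn_small lt).
  exact: ref_step.
rewrite leq_eqVlt ltnNge iN orbF => /eqP E.
have Ei : (i.+1 = (i %/ N).+1 * N)%N by rewrite {1}(divn_eq i N) -addnS -E mulSn addnC.
rewrite Ei mulnK// modnMl ref0.
have := ref_step (subdivide k (i %/ N)) (subdivide k (i %/ N).+1) (i %% N).
by rewrite -E refN.
Qed.

Lemma subdivide_near k i :
  mdist (subdivide k (i %/ N)) (subdivide k.+1 i) <= C%:R * (r / 2 ^+ k).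
Proof.
apply: le_trans (ref_near _ _ _) _; apply: ler_wpM2l => //.
exact: subdivide_step.
Qed.

Let idx k t := Num.truncn (clamp t * (N ^ k)%:R).

Let idxS k t : (idx k.+1 t %/ N)%N = idx k t.
Proof.
rewrite /idx expnSr natrM mulrA truncn_divn// mulr_ge0//.
by case/andP: (clamp_itv t).
Qed.

Let cauchy t k j : (k <= j)%N ->
  mdist (subdivide k (idx k t)) (subdivide j (idx j t)) <= 2 * C%:R * r / 2 ^+ k.
Proof.
move=> /subnKC <-; move: (j - k)%N => {j} j.
(* The difference is the partial sum of the geometric series of the steps. *)
suff : mdist (subdivide k (idx k t)) (subdivide (k + j) (idx (k + j) t)) <=
    2 * C%:R * r / 2 ^+ k - 2 * C%:R * r / 2 ^+ (k + j).
  move=> /le_trans; apply; rewrite lerBlDr lerDl divr_ge0 ?exprn_ge0//.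
  by rewrite !mulr_ge0// mdist_ge0.
elim: j => [|j IH]; first by rewrite addn0 subrr mdistxx.
have := subdivide_near (k + j) (idx (k + j).+1 t).
rewrite idxS addnS => H.
have := metric_triangle (subdivide k (idx k t)) (subdivide (k + j) (idx (k + j) t))
  (subdivide (k + j).+1 (idx (k + j).+1 t)).
move: IH H; rewrite exprS invfM.
set x := 2 ^+ (k + j); set y := 2 ^+ k; move=> IH H H'.
by lra.
Qed.

(** The step functions t |-> subdivide k (floor (t N ^ k)) converge uniformly at
    a geometric rate. Their jumps shrink like 2 ^ -k, so the limit is continuous. *)
Lemma subdivision_path : exists g : R -> X,
  [/\ continuous g, g 0 = a, g 1 = b &
     forall t, mdist a (g t) <= (2 * C%:R + 1) * r].
Proof.
have /choice[g gP] t := compact_cauchy_limit cX (cauchy t).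
have r0 : 0 <= r by exact: mdist_ge0.
have lim0 (K : R) e : 0 < e -> exists k, K / 2 ^+ k < e.
  move=> e0; exists (Num.bound `|K / e|); rewrite ltr_pdivrMr ?exprn_gt0//.
  rewrite mulrC -ltr_pdivrMr//; apply: le_lt_trans (ler_norm _) _.
  apply: lt_le_trans (archi_boundP (normr_ge0 _)) _.
  by rewrite -natrX ler_nat ltnW// ltn_expl.
have limeq t x : (forall k, subdivide k (idx k t) = x) -> g t = x.
  move=> tx; apply/esym/mdist_positivity/eqP; rewrite eq_le mdist_ge0 andbT.
  rewrite leNgt; apply/negP => /(lim0 (2 * C%:R * r))[k].
  by rewrite ltNge -{1}(tx k) gP.
exists g; split.
- apply/continuous_mdistP => t e e0.
  have [k ke] := lim0 (4 * C%:R * r + r) e e0.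
  have N0' : 0 < (N ^ k)%:R :> R by rewrite ltr0n expn_gt0 N0.
  exists ((N ^ k)%:R^-1); first by rewrite invr_gt0.
  move=> s ts; apply: le_lt_trans ke.
  have near (u v : R) : `|u - v| < (N ^ k)%:R^-1 -> (idx k u <= (idx k v).+1)%N.
    move=> uv; apply: truncn_near.
    1,2: by rewrite mulr_ge0//; have /andP[] := clamp_itv u; have /andP[] := clamp_itv v.
    rewrite -mulrBl normrM (gtr0_norm N0') -ltr_pdivlMr// div1r.
    exact: le_lt_trans (clamp_lipschitz _ _) uv.
  have : mdist (subdivide k (idx k t)) (subdivide k (idx k s)) <= r / 2 ^+ k.
    have := near _ _ ts; rewrite distrC in ts; have := near _ _ ts.
    rewrite leq_eqVlt => /predU1P[->|]; first by rewrite subdivide_step.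
    rewrite ltnS => st; rewrite leq_eqVlt => /predU1P[->|].
      by rewrite metric_sym subdivide_step.
    rewrite ltnS => ts'; have -> : idx k t = idx k s by apply/eqP; rewrite eqn_leq ts'.
    by rewrite mdistxx divr_ge0// exprn_ge0.
  have := gP t k; have := gP s k.
  have := metric_triangle (g t) (subdivide k (idx k t)) (g s).
  have := metric_triangle (subdivide k (idx k t)) (subdivide k (idx k s)) (g s).
  rewrite (metric_sym (g t) (subdivide k (idx k t))).
  lra.
- apply: limeq => k; rewrite /idx clamp_id ?lexx ?ler01// mul0r truncn0.
  exact: subdivide0.
- apply: limeq => k; rewrite /idx clamp_id ?lexx ?ler01// mul1r natrK.
  exact: subdivide_last.
- move=> t; have := gP t 0%N; rewrite expr0 divr1.
  have := metric_triangle a (subdivide 0 (idx 0%N t)) (g t).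
  have : mdist a (subdivide 0 (idx 0%N t)) <= r.
    by rewrite /=; case: (idx _ _) => [|_//]; rewrite mdistxx.
  by lra.
Qed.

End Subdivide.

Lemma short_path : compact [set: X] -> doubling X -> bounded_turning X ->
  exists2 C : R, 0 < C & forall a b : X, exists g : R -> X,
  [/\ continuous g, g 0 = a, g 1 = b & forall t, mdist a (g t) <= C * mdist a b].
Proof.
move=> cX dX bX; have [N [C [N0 H]]] := refinement dX bX.
have /choice[ref1 H1] x : exists q : X -> nat -> X, forall y,
  [/\ q y 0%N = x, q y N = y,
      forall i, mdist (q y i) (q y i.+1) <= mdist x y / 2 &
      forall i, mdist x (q y i) <= C%:R * mdist x y].
  by have [q qP] := choice (H x); exists q.
exists (2 * C%:R + 1).
  by have := ler0n R C; lra.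
move=> a b; apply: (@subdivision_path ref1 N C a b) => // x y.
- by case: (H1 x y).
- by case: (H1 x y).
- by case: (H1 x y).
- by case: (H1 x y).
Qed.

End ShortPaths.

(** * Erasing the loops of a path *)

(** The preimage of a closed set V under F is psi (K /\ phi^-1 V), which is
    compact. This gives the continuity of both directions of the arc built
    below at once, with psi and phi exchanged. *)
Lemma quotient_continuous (T Y Z : topologicalType) (K : set T)
    (psi : T -> Y) (phi : T -> Z) (F : Y -> Z) :
  hausdorff_space Y -> compact K -> continuous psi -> continuous phi ->
  (forall c, K c -> F (psi c) = phi c) -> {within psi @` K, continuous F}.
Proof.
move=> hY cK cpsi cphi FE; apply/continuous_closedP => V cV.
apply/closed_subspaceP; exists (psi @` (K `&` phi @^-1` V)).
  apply: compact_closed => //; apply: continuous_compact.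
    exact: continuous_subspaceT.
  by apply: compact_closedI => //; move/continuous_closedP : cphi; exact.
apply/seteqP; split => y [].
  by move=> [c [Kc Vc] <-] _; split; [change (V (F (psi c))); rewrite FE|exists c].
by move=> /= VFy [c Kc cy]; split; exists c => //; split=> //=; rewrite -FE// cy.
Qed.

Lemma compact_dist_bounded (R : realType) (X : metricType R) :
  compact [set: X] -> exists M : R, forall x y : X, mdist x y <= M.
Proof.
move=> cX; have [[x0 _]|X0] := pselect (exists x : X, True); last first.
  by exists 0 => x; case: X0; exists x.
suff [M xM] : exists M, forall x, mdist x0 x <= M.
  exists (M + M) => x y; apply: le_trans (metric_triangle x x0 y) _.
  by rewrite lerD// metric_sym.
apply: contrapT => nM.
have /choice[u uP] n : exists x, n%:R < mdist x0 x.
  apply: contrapT => nx; apply: nM; exists n%:R => x; rewrite leNgt.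
  by apply/negP => xn; apply: nx; exists x.
have [q [_ clq]] := cX (u @ \oo) _ filterT.
pose k := Num.bound (mdist x0 q + 1).
have /clq - /(_ (ball q 1)) :
    (u @ \oo) [set x | exists2 j, (k <= j)%N & x = u j].
  by exists k => // j /= kj; exists j.
case; first exact: nbhsx_ballx.
move=> _ [[j kj ->]]; rewrite ballEmdist/= => qj.
have := metric_triangle x0 q (u j); have := uP j.
have : mdist x0 q + 1 < k%:R by rewrite archi_boundP// addr_ge0 ?mdist_ge0.
by have : k%:R <= j%:R :> R by [rewrite ler_nat]; lra.
Qed.

Section LoopErasure.
Context {R : realType} {X : metricType R}.
Variable g : R -> X.
Hypothesis cg : continuous g.

(** W is the set of erased times, and ]s, t[ the component of r in W: a loop of
    g based at g s = g t. *)
Definition gap (W : set R) (r s t : R) : Prop :=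
  [/\ s < r < t, 0 <= s /\ t <= 1, ~ W s /\ ~ W t,
      forall u, s < u < t -> W u & g s = g t].

Definition erasable (W : set R) := forall r, W r -> exists s t, gap W r s t.

Lemma gap_mono (W W' : set R) r s t s' t' : W `<=` W' ->
  gap W r s t -> gap W' r s' t' -> s' <= s /\ t <= t'.
Proof.
move=> WW' [/andP[sr rt] _ _ st _] [/andP[s'r rt'] _ [ns' nt'] _ _].
split; rewrite leNgt; apply/negP => lt.
- by apply/ns'/WW'/st; rewrite lt (lt_trans s'r).
- by apply/nt'/WW'/st; rewrite lt (lt_trans sr).
Qed.

(** The component of r in the union is the increasing union of its components
    in the members of the chain, and g takes equal values at its ends by
    continuity. *)
Lemma erasable_bigcup (F : set (set R)) : F `<=` erasable ->
  total_on F subset -> erasable (\bigcup_(W in F) W).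
Proof.
move=> FE Ftot r [W0 FW0 W0r].
have join W1 W2 : F W1 -> F W2 -> exists W, [/\ F W, W1 `<=` W & W2 `<=` W].
  by move=> F1 F2; have [?|?] := Ftot _ _ F1 F2; [exists W2; split|exists W1; split].
pose A := [set s | exists W t, F W /\ gap W r s t].
pose B := [set t | exists W s, F W /\ gap W r s t].
have [s0 [t0 g0]] := FE _ FW0 _ W0r.
have hA : has_inf A.
  split; first by exists s0, W0, t0.
  by exists 0 => s [W [t [_ [_ [? _] _ _ _]]]].
have hB : has_sup B.
  split; first by exists t0, W0, s0.
  by exists 1 => t [W [s [_ [_ [_ ?] _ _ _]]]].
have AI s : A s -> inf A <= s by move=> As; apply: ge_inf => //; exact: hA.2.
have BS t : B t -> t <= sup B by move=> Bt; apply: ub_le_sup => //; exact: hB.2.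
have Alt u : inf A < u -> exists2 s, A s & s < u by apply: inf_lt; exact: hA.1.
have Blt u : u < sup B -> exists2 t, B t & u < t by apply: sup_gt; exact: hB.1.
have is0 : inf A <= s0 by apply: AI; exists W0, t0.
have st0 : t0 <= sup B by apply: BS; exists W0, s0.
have [/andP[s0r rt0] _ _ _ _] := g0.
exists (inf A), (sup B); split.
- by rewrite (le_lt_trans is0)//= (lt_le_trans rt0).
- split; first by apply: lb_le_inf; [exact: hA.1|move=> s [W [t [_ [_ [? _] _ _ _]]]]].
  by apply: ge_sup; [exact: hB.1|move=> t [W [s [_ [_ [_ ?] _ _ _]]]]].
- split.
  + move=> [W1 F1 W1s]; have [s1 [t1 [/andP[s1s st1] _ _ in1 _]]] := FE _ F1 _ W1s.
    have [s2 [W2 [t2 [F2 gap2]]] s2t1] := Alt _ st1.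
    have [W [FW W1W W2W]] := join _ _ F1 F2.
    have Wr : W r by apply/W2W; case: gap2 => ? _ _ H _; exact: H.
    have [s' [t' gap']] := FE _ FW _ Wr.
    have [s's2 _] := gap_mono W2W gap2 gap'.
    have : inf A <= s' by apply: AI; exists W, t'.
    have [_ _ [ns' _] _ _] := gap'.
    rewrite le_eqVlt => /predU1P[E|lt]; first by apply/ns'/W1W; rewrite -E.
    apply/ns'/W1W/in1; rewrite (lt_trans s1s lt)/=.
    exact: le_lt_trans s's2 s2t1.
  + move=> [W1 F1 W1s]; have [s1 [t1 [/andP[s1s st1] _ _ in1 _]]] := FE _ F1 _ W1s.
    have [t2 [W2 [s2 [F2 gap2]]] s1t2] := Blt _ s1s.
    have [W [FW W1W W2W]] := join _ _ F1 F2.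
    have Wr : W r by apply/W2W; case: gap2 => ? _ _ H _; exact: H.
    have [s' [t' gap']] := FE _ FW _ Wr.
    have [_ t2t'] := gap_mono W2W gap2 gap'.
    have : t' <= sup B by apply: BS; exists W, s'.
    have [_ _ [_ nt'] _ _] := gap'.
    rewrite le_eqVlt => /predU1P[E|lt]; first by apply/nt'/W1W; rewrite E.
    apply/nt'/W1W/in1; rewrite (lt_trans lt st1) andbT.
    exact: lt_le_trans s1t2 t2t'.
- move=> u /andP[su ut].
  have [ur|ru] := ltP u r.
    have [s [W [t [FW [/andP[_ rt] _ _ H _]]]] su'] := Alt _ su.
    by exists W => //; apply: H; rewrite su' (lt_trans ur).
  have [t [W [s [FW [/andP[sr _] _ _ H _]]]] ut'] := Blt _ ut.
  by exists W => //; apply: H; rewrite ut' (lt_le_trans sr).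
- apply/mdist_positivity/eqP; rewrite eq_le mdist_ge0 andbT.
  apply/ler_addgt0Pl => e e0; rewrite addr0.
  have e20 : 0 < e / 2 by rewrite divr_gt0.
  have /continuous_mdistP cg' := cg.
  have [d1 d10 H1] := cg' (inf A) _ e20; have [d2 d20 H2] := cg' (sup B) _ e20.
  have [|s1 [W1 [t1 [F1 gap1]]] s1s] := Alt (inf A + d1); first by rewrite ltrDl.
  have [|t2 [W2 [s2 [F2 gap2]]] t2t] := Blt (sup B - d2); first by rewrite ltrBlDr ltrDl.
  have [W [FW W1W W2W]] := join _ _ F1 F2.
  have Wr : W r by apply/W2W; case: gap2 => ? _ _ H _; exact: H.
  have [s' [t' gap']] := FE _ FW _ Wr.
  have [s's1 _] := gap_mono W1W gap1 gap'; have [_ t2t'] := gap_mono W2W gap2 gap'.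
  have ? : inf A <= s' by apply: AI; exists W, t'.
  have ? : t' <= sup B by apply: BS; exists W, s'.
  have /H1 : `|inf A - s'| < d1 by rewrite ler0_norm; lra.
  have /H2 : `|sup B - t'| < d2 by rewrite ger0_norm; lra.
  have [_ _ _ _ ->] := gap'; rewrite (metric_sym _ (g t')).
  by have := metric_triangle (g (inf A)) (g t') (g (sup B)); lra.
Qed.

(** After a maximal erasure, g identifies two remaining times only if nothing
    remains between them: otherwise ]s, t[ could be erased too. *)
Lemma maximal_erasure : exists W : set R, erasable W /\
  forall s t, 0 <= s -> s < t -> t <= 1 -> ~ W s -> ~ W t -> g s = g t ->
    forall u, s < u < t -> W u.
Proof.
have [W [EW maxW]] := Zorn_bigcup erasable_bigcup.
exists W; split=> // s t sge0 st tle1 nWs nWt gst u ust.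
pose W' := W `|` [set u | s < u < t].
apply: contrapT => nWu; apply: (maxW W').
  split; first by move=> x; left.
  by move=> /(_ u) H; apply: nWu; apply: H; right.
have nW's : ~ W' s by move=> [//|] /=; rewrite ltxx.
have nW't : ~ W' t by move=> [//|] /=; rewrite ltxx andbF.
move=> r W'r; have [rst|nrst] := pselect (s < r < t).
  by exists s, t; split=> // x xst; right.
case: W'r => // Wr; have [s1 [t1 [/andP[s1r rt1] [s10 t11] [ns1 nt1] H g1]]] := EW _ Wr.
have sN : ~ (s1 < s < t1) by move=> /H.
have tN : ~ (s1 < t < t1) by move=> /H.
have ts : t <= s1 \/ t1 <= s.
  have [rs|sr] := leP r s.
    by right; rewrite leNgt; apply/negP => lt; apply: sN; rewrite lt (lt_le_trans s1r).
  have tr : t <= r by rewrite leNgt; apply/negP => lt; apply: nrst; rewrite sr.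
  by left; rewrite leNgt; apply/negP => lt; apply: tN; rewrite lt (le_lt_trans tr).
exists s1, t1; split=> //; first by rewrite s1r.
  split; (case=> //= => /andP[? ?]); case: ts => ?; lra.
by move=> x xs; left; apply: H.
Qed.

End LoopErasure.

(** * The arc left after erasing loops *)

Section ErasedArc.
Context {R : realType} {X : metricType R}.
Variables (g : R -> X) (W : set R) (M : R).
Hypothesis cg : continuous g.
Hypothesis XM : forall x y : X, mdist x y <= M.
Hypothesis erasableW : erasable g W.
Hypothesis maxW : forall s t, 0 <= s -> s < t -> t <= 1 -> ~ W s -> ~ W t ->
  g s = g t -> forall u, s < u < t -> W u.

Definition kept : set R := `[0, 1] `\` W.

Lemma keptP t : kept t <-> 0 <= t <= 1 /\ ~ W t.
Proof. by rewrite /kept /setD /= in_itv. Qed.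

Lemma kept0 : kept 0.
Proof.
apply/keptP; rewrite lexx ler01; split=> // /erasableW[s [t [/andP[s0 _] [s0' _] _ _ _]]].
by move: s0; rewrite ltNge s0'.
Qed.

Lemma kept1 : kept 1.
Proof.
apply/keptP; rewrite lexx ler01; split=> // /erasableW[s [t [/andP[_ t1] [_ t1'] _ _ _]]].
by move: t1; rewrite ltNge t1'.
Qed.

Lemma openW : open W.
Proof.
rewrite openE => r /erasableW[s [t [/andP[sr rt] _ _ st _]]].
apply/nbhs_ballP; exists (Num.min (r - s) (t - r)) => /=.
  by rewrite lt_min !subr_gt0 sr.
move=> u; rewrite /ball /= lt_min !ltr_norml => /andP[/andP[? ?] /andP[? ?]].
by apply: st; apply/andP; split; lra.
Qed.

Lemma kept_compact : compact kept.
Proof.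
rewrite /kept setDE; apply: compact_closedI; first exact: segment_compact.
exact: open_closedC openW.
Qed.

(** For fixed q, a nondecreasing function of t that is constant on erased loops
    and vanishes for t <= q. The singleton makes the supremum 0 if there is no
    time to consider. *)
Definition kept_osc (q t : R) : R := sup ([set 0] `|`
  [set x | exists s s', [/\ kept s, kept s', q <= s <= s', s' <= t &
     x = mdist (g s) (g s')]]).

Let osc_sup q t : has_sup ([set 0] `|`
  [set x | exists s s', [/\ kept s, kept s', q <= s <= s', s' <= t &
     x = mdist (g s) (g s')]]).
Proof.
split; first by exists 0; left.
exists (Num.max 0 M) => x [->|[s [s' [_ _ _ _ ->]]]]; rewrite le_max ?lexx//.
by rewrite XM orbT.
Qed.

Lemma kept_osc_ge0 q t : 0 <= kept_osc q t.
Proof. by apply: ub_le_sup; [exact: (osc_sup q t).2|left]. Qed.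

Lemma le_kept_osc q t s s' : kept s -> kept s' -> q <= s <= s' -> s' <= t ->
  mdist (g s) (g s') <= kept_osc q t.
Proof.
by move=> ks ks' qs st; apply: ub_le_sup; [exact: (osc_sup q t).2|right; exists s, s'].
Qed.

Lemma kept_osc_le q t e : 0 <= e -> (forall s s', kept s -> kept s' ->
    q <= s <= s' -> s' <= t -> mdist (g s) (g s') <= e) -> kept_osc q t <= e.
Proof.
move=> e0 H; apply: ge_sup; first exact: (osc_sup q t).1.
by move=> x [->//|[s [s' [ks ks' qs st ->]]]]; exact: H.
Qed.

Lemma kept_osc_leM q t : 0 <= M -> kept_osc q t <= M.
Proof. by move=> M0; apply: kept_osc_le. Qed.

Lemma kept_osc_mono q t t' : t <= t' -> kept_osc q t <= kept_osc q t'.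
Proof.
move=> tt'; apply: kept_osc_le; first exact: kept_osc_ge0.
by move=> s s' ks ks' qs st; apply: le_kept_osc => //; exact: le_trans tt'.
Qed.

(** If t lies in an erased interval ]a, b[, the path is cut at g a = g b instead
    of g t. *)
Lemma kept_osc_add q t t' e : 0 <= e -> 
  (forall u v, t <= u <= t' -> t <= v <= t' -> mdist (g u) (g v) <= e) ->
  kept_osc q t' <= kept_osc q t + e.
Proof.
move=> e0 H; apply: kept_osc_le; first by rewrite addr_ge0// kept_osc_ge0.
move=> s s' ks ks' /andP[qs ss'] s't'.
have [s't|ts'] := leP s' t.
  by rewrite -[leLHS]addr0 lerD// le_kept_osc// qs.
have [ts|st] := leP t s.
  rewrite -[leLHS]add0r lerD ?kept_osc_ge0// H//; apply/andP; split; lra.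
have /keptP[/andP[s0 _] nWs] := ks; have /keptP[/andP[_ s1] nWs'] := ks'.
have [Wt|nWt] := pselect (W t).
  have [a [b [/andP[a_t tb] [a0 b1] [nWa nWb] H' gab]]] := erasableW Wt.
  have sa : s <= a.
    by rewrite leNgt; apply/negP => lt; apply/nWs/H'; rewrite lt (lt_trans st).
  have bs' : b <= s'.
    by rewrite leNgt; apply/negP => lt; apply/nWs'/H'; rewrite lt (lt_trans a_t).
  apply: le_trans (metric_triangle _ (g a) _) _; apply: lerD.
    apply: le_kept_osc => //; [apply/keptP|by rewrite qs|exact: ltW].
    by split=> //; apply/andP; split; lra.
  by rewrite gab; apply: H; apply/andP; split; lra.
apply: le_trans (metric_triangle _ (g t) _) _; apply: lerD.
  apply: le_kept_osc => //; last by rewrite qs ltW.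
  by apply/keptP; split=> //; apply/andP; split; lra.
by apply: H; apply/andP; split; lra.
Qed.

Lemma kept_osc_loop q s s' : kept s -> kept s' -> s <= s' -> g s = g s' ->
  kept_osc q s' <= kept_osc q s.
Proof.
rewrite [s <= _]le_eqVlt => ks ks' /predU1P[->//|ss'] gs.
have between u : kept u -> u <= s' -> u <= s \/ u = s'.
  move=> /keptP[_ nWu] us'; have [|su] := leP u s; first by left.
  right; apply/eqP; rewrite eq_le us' leNgt; apply/negP => lt.
  move/keptP: ks => [/andP[s0 _] nWs]; move/keptP: ks' => [/andP[_ s1] nWs'].
  by apply: nWu; apply: (maxW s0 ss') => //; rewrite su.
apply: kept_osc_le; first exact: kept_osc_ge0.
move=> u v ku kv /andP[qu uv] vs'.
have [us|us'] := between u ku (le_trans uv vs').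
  have [vs|->] := between v kv vs'; first by apply: le_kept_osc; rewrite ?qu.
  by rewrite -gs; apply: le_kept_osc; rewrite ?qu.
have -> : v = u by apply/eqP; rewrite eq_le uv us' vs'.
by rewrite mdistxx kept_osc_ge0.
Qed.

Lemma kept_osc_gap q s t : (forall u, s < u <= t -> W u) ->
  kept_osc q t <= kept_osc q s.
Proof.
move=> st; apply: kept_osc_le; first exact: kept_osc_ge0.
move=> u v ku kv quv vt; apply: le_kept_osc => //.
rewrite leNgt; apply/negP => sv; move/keptP: kv => [_]; apply; apply: st.
by rewrite sv.
Qed.

Definition ratn n : R := ratr (odflt 0 (unpickle n)).

Definition weighted N t := \sum_(n < N) kept_osc (ratn n) t / 2 ^+ n.+1.

(** The sum over all rationals q of weighted multiples of the functions
    [kept_osc q]. Each of them may be constant on some stretch of the arc; the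
    sum is not. It is written as a supremum of partial sums. *)
Definition height t : R := sup [set weighted N t | N in [set: nat]].

Lemma sum_halves N : \sum_(n < N) (2 ^+ n.+1)^-1 = 1 - (2 ^+ N)^-1 :> R.
Proof.
elim: N => [|N IH]; first by rewrite big_ord0 expr0 invr1 subrr.
by rewrite big_ord_recr /= IH exprS invfM; field; rewrite expf_neq0.
Qed.

Lemma weighted_add N t t' e : 0 <= e ->
  (forall q, kept_osc q t' <= kept_osc q t + e) ->
  weighted N t' <= weighted N t + e.
Proof.
move=> e0 H; apply: (@le_trans _ _ (\sum_(n < N)
    (kept_osc (ratn n) t / 2 ^+ n.+1 + e * (2 ^+ n.+1)^-1))).
  apply: ler_sum => n _; rewrite -mulrDl ler_wpM2r// invr_ge0 exprn_ge0.
rewrite big_split /= lerD2l -mulr_sumr sum_halves.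
by rewrite -[leRHS]mulr1 ler_wpM2l// lerBlDr lerDl invr_ge0 exprn_ge0.
Qed.

Lemma weighted_mono N N' t : (N <= N')%N -> weighted N t <= weighted N' t.
Proof.
move=> /subnKC <-; elim: (N' - N)%N => [|k IH]; first by rewrite addn0.
rewrite addnS; apply: le_trans IH _.
by rewrite /weighted big_ord_recr /= lerDl divr_ge0 ?exprn_ge0 ?kept_osc_ge0.
Qed.

Let height_sup t : has_sup [set weighted N t | N in [set: nat]].
Proof.
split; first by exists (weighted 0 t), 0%N.
have M0 : 0 <= M by rewrite -(mdistxx (g 0)) XM.
exists M => _ [N _ <-]; rewrite /weighted.
apply: (@le_trans _ _ (\sum_(n < N) M * (2 ^+ n.+1)^-1)).
  by apply: ler_sum => n _; rewrite ler_pM2r ?kept_osc_leM// invr_gt0 exprn_gt0.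
rewrite -mulr_sumr sum_halves.
by rewrite -[leRHS]mulr1 ler_wpM2l// lerBlDr lerDl invr_ge0 exprn_ge0.
Qed.

Lemma weighted_le N t : weighted N t <= height t.
Proof. by apply: ub_le_sup; [exact: (height_sup t).2|exists N]. Qed.

Lemma height_add t t' e : 0 <= e ->
  (forall q, kept_osc q t' <= kept_osc q t + e) -> height t' <= height t + e.
Proof.
move=> e0 H; apply: ge_sup; first exact: (height_sup t').1.
move=> _ [N _ <-]; apply: le_trans (weighted_add N e0 H) _.
by rewrite lerD2r weighted_le.
Qed.

Lemma height_le t t' : (forall q, kept_osc q t' <= kept_osc q t) ->
  height t' <= height t.
Proof.
by move=> H; rewrite -[leRHS]addr0; apply: height_add => // q; rewrite addr0.
Qed.

Lemma height_mono t t' : t <= t' -> height t <= height t'.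
Proof. by move=> tt'; apply: height_le => q; exact: kept_osc_mono. Qed.

(** Pick a kept u in ]s, t[ with g u <> g t and a rational q in ]s, u[. The term
    of index q vanishes at s and is at least d(g u, g t) at t. *)
Lemma height_strict s t : kept s -> kept t -> s < t -> g s <> g t ->
  height s < height t.
Proof.
move=> ks kt st gst.
have /keptP[/andP[s0 _] nWs] := ks; have /keptP[/andP[_ t1] nWt] := kt.
(* The kept times meet ]s, t[; if the first point found has the image g t,
   take another one before it. *)
have [u ku [su ut gut]] : exists2 u, kept u & [/\ s < u, u < t & g u <> g t].
  have pick x y : kept x -> kept y -> x < y -> g x <> g y ->
      exists2 u, kept u & x < u < y.
    move=> kx ky xy gxy; apply: contrapT => nu; apply: gxy.
    have Wu u : x < u < y -> W u.
      move=> xuy; apply: contrapT => nWu; apply: nu; exists u => //.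
      move/keptP: kx => [/andP[x0 _] _]; move/keptP: ky => [/andP[_ y1] _].
      by apply/keptP; split=> //; move/andP: xuy => [? ?]; apply/andP; split; lra.
    have Wm : W ((x + y) / 2) by apply: Wu; apply/andP; split; lra.
    have [a [b [/andP[am mb] _ [nWa nWb] ab gab]]] := erasableW Wm.
    move/keptP: kx => [_ nWx]; move/keptP: ky => [_ nWy].
    have xa : x <= a.
      rewrite leNgt; apply/negP => lt; apply/nWx/ab; rewrite lt/=.
      by apply: lt_trans mb; lra.
    have by' : b <= y.
      rewrite leNgt; apply/negP => lt; apply/nWy/ab; rewrite lt andbT.
      by apply: lt_trans am _; lra.
    have <- : a = x.
      apply/eqP; rewrite eq_le xa andbT leNgt; apply/negP => lt.
      by apply/nWa/Wu; rewrite lt/=; lra.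
    have <- // : b = y.
    apply/eqP; rewrite eq_le by' /= leNgt; apply/negP => lt.
    by apply/nWb/Wu; rewrite lt andbT; lra.
  have [u ku /andP[su ut]] := pick _ _ ks kt st gst.
  have [gut|gut] := pselect (g u = g t); last by exists u.
  have [v kv /andP[sv vu]] := pick _ _ ks ku su ltac:(by rewrite gut).
  exists v => //; split=> //; first exact: lt_trans ut.
  move=> gvt; move/keptP: ku => [_]; apply.
  move/keptP: kv => [/andP[v0 _] nWv].
  by apply: (maxW v0 (lt_trans vu ut)) => //; rewrite vu.
have [q] := rat_in_itvoo su; rewrite in_itv /= => /andP[sq qu].
pose n := pickle q; have rn : ratn n = ratr q by rewrite /ratn pickleK.
have d0 : 0 < mdist (g u) (g t) by rewrite mdist_gt0; apply/eqP.
have oscs : kept_osc (ratn n) s = 0.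
  apply/eqP; rewrite eq_le kept_osc_ge0 andbT; apply: kept_osc_le => // x y _ _.
  by rewrite rn => /andP[? ?] ?; lra.
have osct : mdist (g u) (g t) <= kept_osc (ratn n) t.
  by apply: le_kept_osc => //; rewrite rn (ltW qu) ltW.
set e := mdist (g u) (g t) / 2 ^+ n.+1.
have e0 : 0 < e by rewrite divr_gt0 ?exprn_gt0.
suff : height s <= height t - e by lra.
apply: ge_sup; first exact: (height_sup s).1.
move=> _ [N _ <-]; rewrite lerBrDr.
pose N' := maxn N n.+1.
have ltn' : (n < N')%N by rewrite leq_maxr.
apply: (@le_trans _ _ (weighted N' s + e)).
  by rewrite lerD2r weighted_mono// leq_maxl.
apply: le_trans (weighted_le N' t).
rewrite /weighted (bigD1 (Ordinal ltn')) //= [leRHS](bigD1 (Ordinal ltn')) //=.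
rewrite oscs mul0r add0r [leLHS]addrC; apply: lerD.
  by rewrite ler_pM2r// invr_gt0 exprn_gt0.
apply: ler_sum => k _; rewrite ler_pM2r ?invr_gt0 ?exprn_gt0//.
by apply: kept_osc_mono; exact: ltW.
Qed.

Lemma height_eq s t : kept s -> kept t -> height s = height t <-> g s = g t.
Proof.
move=> ks kt; wlog st : s t ks kt / s <= t.
  move=> H; have [|/ltW] := leP s t; first exact: H.
  by move=> /(H _ _ kt ks)[? ?]; split=> E; symmetry; auto.
split=> [E|E].
  apply: contrapT => gst; move: st; rewrite le_eqVlt => /predU1P[E'|lt].
    by rewrite E' in gst.
  by have := height_strict ks kt lt gst; rewrite E ltxx.
apply/eqP; rewrite eq_le height_mono//=; apply: height_le => q.
exact: kept_osc_loop.
Qed.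

(** Each term grows from a to b by at most the oscillation of g on [a, b], and
    the weights sum to at most 1. *)
Lemma height_continuous : continuous height.
Proof.
move=> t; apply/cvgrPdist_le => e e0.
have e20 : 0 < e / 2 by rewrite divr_gt0.
have /continuous_mdistP/(_ t _ e20)[d d0 gd] := cg.
have nbr u v : `|t - u| < d -> `|t - v| < d -> mdist (g u) (g v) <= e.
  move=> /gd tu /gd tv; have := metric_triangle (g u) (g t) (g v).
  by rewrite (metric_sym (g u) (g t)); lra.
have step a b : a <= b -> `|t - a| < d -> `|t - b| < d ->
    height b <= height a + e.
  move=> ab; rewrite !ltr_norml => /andP[? ?] /andP[? ?].
  apply: height_add; first exact: ltW.
  move=> q; apply: kept_osc_add; first exact: ltW.
  by move=> u v /andP[? ?] /andP[? ?]; apply: nbr; rewrite ltr_norml;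
    apply/andP; split; lra.
near=> u.
have tu : `|t - u| < d by near: u; exact: cvgr_dist_lt.
have tt : `|t - t| < d by rewrite subrr normr0.
rewrite ler_norml; have [ut|/ltW ut] := leP u t.
  have := step _ _ ut tu tt; have := height_mono ut.
  by move=> *; apply/andP; split; lra.
have := step _ _ ut tt tu; have := height_mono ut.
by move=> *; apply/andP; split; lra.
Unshelve. all: by end_near. Qed.

Lemma height0 : height 0 = 0.
Proof.
have w0 q : kept_osc q 0 = 0.
  apply/eqP; rewrite eq_le kept_osc_ge0 andbT; apply: kept_osc_le => //.
  move=> s s' /keptP[/andP[s0 _] _] _ /andP[_ ss'] s'0.
  have -> : s = s' by apply/eqP; rewrite eq_le ss' (le_trans s'0).
  by rewrite mdistxx.
apply/eqP; rewrite eq_le; apply/andP; split.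
  apply: ge_sup; first exact: (height_sup 0).1.
  by move=> _ [N _ <-]; rewrite /weighted big1// => n _; rewrite w0 mul0r.
apply: le_trans (weighted_le 0 0).
by rewrite /weighted big_ord0.
Qed.

Lemma height_onto y : 0 <= y <= height 1 -> exists2 c, kept c & height c = y.
Proof.
move=> y01; have h1 : 0 <= height 1 by rewrite -height0 height_mono.
have [||c] := @IVT _ height 0 1 y ler01.
- by apply: continuous_subspaceT; exact: height_continuous.
- by rewrite height0 min_l// max_r.
rewrite in_itv /= => c01 cy; have [Wc|nWc] := pselect (W c); last first.
  by exists c => //; apply/keptP.
have [a [b [/andP[ac cb] [a0 b1] [nWa nWb] ab _]]] := erasableW Wc.
exists a.
  by apply/keptP; split=> //; apply/andP; split=> //; lra.
rewrite -cy; apply/eqP; rewrite eq_le height_mono ?(ltW ac)//=.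
apply: height_le => q; apply: kept_osc_gap => u /andP[au uc].
by apply: ab; rewrite au (le_lt_trans uc).
Qed.

(** On the kept times, the normalized height and g identify the same pairs, so
    each factors through the other; the two factors are inverse
    homeomorphisms between [0, 1] and the image of the kept times. *)
Lemma erased_arc : g 0 <> g 1 -> exists A,
  jordan_arc (g 0) (g 1) A /\ A `<=` g @` `[0, 1].
Proof.
move=> g01.
have h1 : 0 < height 1.
  by rewrite -height0 height_strict//; [exact: kept0|exact: kept1].
have hn0 : height 1 != 0 by rewrite gt_eqF.
pose psi c := height c / height 1.
have cpsi : continuous psi.
  by move=> c; apply: continuousM; [exact: height_continuous|exact: cst_continuous].
have psi_eq s t : kept s -> kept t -> psi s = psi t <-> g s = g t.
  move=> ks kt; rewrite -height_eq//; split=> [|E]; last by rewrite /psi E.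
  by move=> /mulIf; apply; rewrite invr_eq0.
have psi01 : psi @` kept = `[0, 1]%classic.
  apply/seteqP; split=> [_ [c kc <-]|y] /=; rewrite in_itv /=.
    have /keptP[/andP[c0 c1] _] := kc.
    rewrite /psi divr_ge0 ?ler_pdivrMr ?mul1r ?height_mono//; last exact: ltW.
    by rewrite -height0 height_mono.
  move=> /andP[y0 y1].
  have [|c kc hc] := @height_onto (y * height 1).
    by rewrite mulr_ge0 ?(ltW h1)//= -[leRHS]mul1r ler_wpM2r// ltW.
  by exists c => //; rewrite /psi hc mulfK.
pose inv1 y := xget 0 [set c | kept c /\ psi c = y].
pose inv2 p := xget 0 [set c | kept c /\ g c = p].
have inv1P c : kept c -> kept (inv1 (psi c)) /\ psi (inv1 (psi c)) = psi c.
  move=> kc; rewrite /inv1; case: xgetP => [x _ [kx xE]|/(_ c)[]//].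
  by split.
have inv2P c : kept c -> kept (inv2 (g c)) /\ g (inv2 (g c)) = g c.
  move=> kc; rewrite /inv2; case: xgetP => [x _ [kx xE]|/(_ c)[]//].
  by split.
pose F y := g (inv1 y); pose G p := psi (inv2 p).
have FE c : kept c -> F (psi c) = g c.
  by move=> kc; have [kc' E] := inv1P _ kc; apply/(psi_eq _ _ kc' kc).
have GE c : kept c -> G (g c) = psi c.
  by move=> kc; have [kc' E] := inv2P _ kc; apply/(psi_eq _ _ kc' kc).
have FG y : `[0, 1]%classic y -> exists c, [/\ kept c, psi c = y & F y = g c].
  by rewrite -psi01 => -[c kc <-]; exists c; split=> //; rewrite FE.
exists (g @` kept); split; last first.
  by move=> _ [c /keptP[c01 _] <-]; exists c => //=; rewrite in_itv.
exists F, G; split.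
- split.
    rewrite -psi01.
    exact: quotient_continuous (@Rhausdorff R) kept_compact cpsi cg FE.
  exact: quotient_continuous (@metric_hausdorff R X) kept_compact cg cpsi GE.
- split.
  + by move=> y /FG[c [kc _ ->]]; exists c.
  + move=> y z; rewrite !inE => /FG[c [kc <- ->]] /FG[c' [kc' <- ->]].
    by move/(psi_eq _ _ kc kc').
  + move=> _ [c kc <-]; exists (psi c); last exact: FE.
    by rewrite -psi01; exists c.
- by move=> y y01; have [c [kc <- ->]] := FG y y01; rewrite GE.
- by rewrite -[X in F X](_ : psi 0 = 0) ?FE//; [exact: kept0|rewrite /psi height0 mul0r].
- by rewrite -[X in F X](_ : psi 1 = 1) ?FE//; [exact: kept1|rewrite /psi divff].
Qed.

End ErasedArc.

Lemma arc_in_path (R : realType) (X : metricType R) (g : R -> X) :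
  compact [set: X] -> continuous g -> g 0 <> g 1 ->
  exists A, jordan_arc (g 0) (g 1) A /\ A `<=` g @` `[0, 1].
Proof.
move=> cX cg g01; have [M XM] := compact_dist_bounded cX.
have [W [EW maxW]] := maximal_erasure cg.
exact: erased_arc XM EW maxW g01.
Qed.

(** * Segments in a uniquely arc-connected space *)

Section ArcParametrization.
Context {R : realType} {X : metricType R}.

(** The first alternative makes [seg x x] the singleton, as no Jordan arc has
    equal end points. *)
Definition seg (x y : X) : set X :=
  [set z | z = x \/ exists2 A, jordan_arc x y A & A z].

Definition parametrizes (a : R -> X) x y := [/\ continuous a, a 0 = x, a 1 = y &
  forall s t, 0 <= s -> s <= t -> t <= 1 -> seg (a s) (a t) = a @` `[s, t]].

Lemma clamp_continuous (f : R -> X) :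
  {within `[0, 1], continuous f} -> continuous (f \o clamp).
Proof.
move=> /subspace_continuousP cf; apply/continuous_mdistP => t e e0.
have ct : `[0, 1]%classic (clamp t) by rewrite /= in_itv /= clamp_itv.
have /cvg_ballP/(_ _ e0) := cf _ ct; rewrite near_withinE.
move=> /nbhs_ballP[d /= d0 H]; exists d => // s ts.
have := H (clamp s); rewrite !ballEmdist /=; apply.
  exact: le_lt_trans (clamp_lipschitz _ _) ts.
by rewrite /= in_itv /= clamp_itv.
Qed.

Lemma affine_continuous (c d : R) : continuous (fun t : R => c * t + d).
Proof. by move=> t; apply: cvgD; [apply: cvgM; [exact: cvg_cst|exact: cvg_id]|exact: cvg_cst]. Qed.

Lemma subarc (a : R -> X) (g : X -> R) A s t : continuous a ->
  {within A, continuous g} -> a @` `[0, 1] `<=` A ->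
  {in `[0, 1], cancel a g} ->
  0 <= s -> s < t -> t <= 1 -> jordan_arc (a s) (a t) (a @` `[s, t]).
Proof.
move=> ca cg aA ag s0 st t1; have ts0 : 0 < t - s by rewrite subr_gt0.
pose phi u := (t - s) * u + s.
have phi_itv u : (u \in `[0, 1]) -> phi u \in `[s, t].
  rewrite !in_itv /= => /andP[u0 u1]; rewrite /phi lerDr mulr_ge0 ?(ltW ts0)//=.
  by rewrite -lerBrDr -[leRHS]mulr1 ler_pM2l.
have sub01 u : u \in `[s, t] -> u \in `[0, 1].
  by rewrite !in_itv /= => /andP[? ?]; apply/andP; split; lra.
have phi_onto u : u \in `[s, t] -> exists2 v, v \in `[0, 1] & phi v = u.
  rewrite in_itv /= => /andP[su ut]; exists ((u - s) / (t - s)).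
    by rewrite in_itv /= divr_ge0 ?subr_ge0 ?(ltW st)//= ler_pdivrMr// mul1r lerD2r.
  by rewrite /phi; field; rewrite gt_eqF.
have phi_inj : injective phi.
  by move=> u v; rewrite /phi => /addIr; apply: mulfI; rewrite gt_eqF.
have ainj u v : u \in `[0, 1] -> v \in `[0, 1] -> a u = a v -> u = v.
  by move=> u01 v01 E; rewrite -(ag u)// -(ag v)// E.
exists (a \o phi), (fun p => (t - s)^-1 * g p + - ((t - s)^-1 * s)); split.
- split.
    apply: continuous_subspaceT => u; apply: continuous_comp; last exact: ca.
    exact: affine_continuous.
  have : {within a @` `[s, t], continuous g}.
    apply: continuous_subspaceW cg => _ [u ust <-]; apply: aA; exists u => //.
    exact: sub01.
  move=> cg' p; apply: (@continuous_comp _ _ _ (g : subspace (a @` `[s, t]) -> R)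
    (fun u => (t - s)^-1 * u + - ((t - s)^-1 * s)) p); first exact: cg'.
  exact: affine_continuous.
- split.
  + by move=> u u01; exists (phi u) => //=; exact: phi_itv.
  + move=> u v; rewrite !inE => u01 v01 /= /ainj E; apply/phi_inj/E; apply/sub01/phi_itv => //.
  + move=> _ [u ust <-]; have [v v01 <-] := phi_onto _ ust; by exists v.
- move=> u u01 /=; rewrite ag; last exact/sub01/phi_itv.
  by rewrite /phi; field; rewrite gt_eqF.
- by rewrite /phi /= mulr0 add0r.
- by rewrite /phi /= mulr1 subrK.
Qed.

End ArcParametrization.

Section Segments.
Context {R : realType} {X : metricType R}.
Hypothesis cX : compact [set: X].
Implicit Types x y z u v p q : X.
Hypothesis arcX : forall u v : X, u <> v -> exists! A : set X, jordan_arc u v A.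

Lemma seg_arc (x y : X) A : x <> y -> jordan_arc x y A -> seg x y = A.
Proof.
move=> xy xyA; have [B [_ uniqB]] := arcX xy.
have BA := uniqB _ xyA; apply/seteqP; split=> [z [->|[A' xyA' A'z]]|z Az].
- have [f [g [_ [fun01 _ _] _ <- _]]] := xyA.
  by apply: fun01; rewrite /= in_itv /= lexx ler01.
- by rewrite -BA (uniqB _ xyA').
- by right; exists A.
Qed.

Lemma segxx (x : X) : seg x x = [set x].
Proof.
apply/seteqP; split=> [z [->//|[A [f [g [_ _ fg f0 f1]]] _]]|z ->]; last by left.
have /eqP : 0 = 1 :> R.
  have i0 : (0 : R) \in `[0, 1] by rewrite in_itv /= lexx ler01.
  have i1 : (1 : R) \in `[0, 1] by rewrite in_itv /= lexx ler01.
  by have := fg _ i0; rewrite f0 -f1 fg// => ->.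
by rewrite eq_sym oner_eq0.
Qed.

Lemma seg_param (x y : X) : exists a, parametrizes a x y.
Proof.
have [<-|/eqP xy] := eqVneq x y.
  exists (fun=> x); split=> //; first by move=> ?; exact: cvg_cst.
  move=> s t s0 st t1; rewrite segxx; apply/seteqP; split=> [_ ->|_ [? _ <-]//].
  by exists s => //=; rewrite in_itv /= lexx.
have [A [xyA _]] := arcX xy.
have [f [g [[cf cg] [fun01 _ _] fg f0 f1]]] := xyA.
have fE t : t \in `[0, 1] -> f (clamp t) = f t by rewrite in_itv /= => /clamp_id ->.
have i0 : (0 : R) \in `[0, 1] by rewrite in_itv /= lexx ler01.
have i1 : (1 : R) \in `[0, 1] by rewrite in_itv /= lexx ler01.
have ca := clamp_continuous cf.
have fg' : {in `[0, 1], cancel (f \o clamp) g} by move=> t t01 /=; rewrite fE// fg.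
exists (f \o clamp); split; rewrite ?/comp ?fE//.
move=> s t s0; rewrite le_eqVlt => /predU1P[<-|st] t1.
  rewrite segxx; apply/seteqP; split=> [_ ->|_ [u + <-]].
    by exists s => //=; rewrite in_itv /= lexx.
  by rewrite /= in_itv /= -eq_le => /eqP ->.
apply: seg_arc.
  move=> E; have : s = t.
    rewrite -(fg' s) ?in_itv /= ?s0 ?(le_trans (ltW st))// E fg' //.
    by rewrite in_itv /= t1 (le_trans s0)// ltW.
  by move=> E'; rewrite E' ltxx in st.
apply: (subarc ca cg) => //.
by move=> _ [u u01 <-] /=; rewrite fE//; exact: fun01.
Qed.

(** The arc inside the path is the only arc between its ends. *)
Lemma path_covers_seg (g : R -> X) : continuous g ->
  seg (g 0) (g 1) `<=` g @` `[0, 1].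
Proof.
move=> cg; have [<-|/eqP g01] := eqVneq (g 0) (g 1).
  by rewrite segxx => _ ->; exists 0 => //=; rewrite in_itv /= lexx ler01.
have [A [gA Ag]] := arc_in_path cX cg g01.
by rewrite (seg_arc g01 gA).
Qed.

Lemma seg_image (x y : X) a : parametrizes a x y -> seg x y = a @` `[0, 1].
Proof. by move=> [_ <- <- ->]//; rewrite lexx ler01. Qed.

Lemma seg_left (x y : X) : seg x y x. Proof. by left. Qed.

Lemma seg_right (x y : X) : seg x y y.
Proof.
have [a pa] := seg_param x y; rewrite (seg_image pa); have [_ _ <- _] := pa.
by exists 1 => //=; rewrite in_itv /= ler01 lexx.
Qed.

Lemma seg_subC (x y : X) : seg y x `<=` seg x y.
Proof.
have [a pa] := seg_param x y; rewrite (seg_image pa); have [ca a0 a1 _] := pa.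
pose b t := a ((-1) * t + 1).
have cb : continuous b.
  by move=> t; apply: continuous_comp; [exact: affine_continuous|exact: ca].
have -> : seg y x = seg (b 0) (b 1).
  by rewrite /b mulr0 add0r mulr1 addNr a0 a1.
move=> z /(path_covers_seg cb)[t /= t01 <-]; exists (-1 * t + 1) => //=.
by move: t01; rewrite !in_itv /= => /andP[? ?]; apply/andP; split; lra.
Qed.

Lemma segC (x y : X) : seg x y = seg y x.
Proof. by apply/seteqP; split; exact: seg_subC. Qed.

(** The concatenation of the arcs from x to z and from z to y is a path. *)
Lemma seg_tri (x z y : X) : seg x y `<=` seg x z `|` seg z y.
Proof.
have [a pa] := seg_param x z; have [b pb] := seg_param z y.
rewrite (seg_image pa) (seg_image pb).
have [ca a0 a1 _] := pa; have [cb b0 b1 _] := pb.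
pose l t := a (2 * t + 0); pose r t := b (2 * t - 1).
have cl : continuous l.
  by move=> t; apply: continuous_comp; [exact: affine_continuous|exact: ca].
have cr : continuous r.
  by move=> t; apply: continuous_comp; [exact: affine_continuous|exact: cb].
pose g t := if t <= 2^-1 then l t else r t.
have cg : continuous g.
  apply/continuous_subspace_setT.
  have -> : setT = [set t : R | t <= 2^-1] `|` [set t | 2^-1 <= t].
    by apply/seteqP; split=> // t _ /=; case: (leP t 2^-1) => [|/ltW]; [left|right].
  apply: withinU_continuous; [exact: closed_le|exact: closed_ge| |].
    apply: (@subspace_eq_continuous _ _ _ l); last exact: continuous_subspaceT.
    by move=> t; rewrite inE => tl; change (l t = g t); rewrite /g ifT.
  apply: (@subspace_eq_continuous _ _ _ r); last exact: continuous_subspaceT.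
  move=> t; rewrite inE => tl; change (r t = g t); rewrite /g; case: leP => // tr.
  have -> : t = 2^-1 by apply/eqP; rewrite eq_le tl tr.
  by rewrite /l /r divff// addr0 subrr a1 b0.
have -> : seg x y = seg (g 0) (g 1).
  rewrite /g ifT; last by rewrite invr_ge0.
  rewrite ifF; last by apply/negbTE; rewrite -ltNge invf_lt1// ltr1n.
  by rewrite /l /r mulr0 addr0 mulr1 -[X in X - 1]/(1 + 1) addrK a0 b1.
move=> w /(path_covers_seg cg)[t /= + <-]; rewrite in_itv /= => /andP[t0 t1].
rewrite /g; case: leP => t2; [left; exists (2 * t + 0)|right; exists (2 * t - 1)] => //=;
  by rewrite in_itv /=; apply/andP; split; lra.
Qed.

Lemma seg_compact (x y : X) : compact (seg x y).
Proof.
have [a pa] := seg_param x y; rewrite (seg_image pa); have [ca _ _ _] := pa.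
by apply: continuous_compact; [exact: continuous_subspaceT|exact: segment_compact].
Qed.

Lemma seg_closed (x y : X) : closed (seg x y).
Proof. exact: compact_closed (@metric_hausdorff R X) (@seg_compact x y). Qed.

Lemma seg_connected (x y : X) : connected (seg x y).
Proof.
have [a pa] := seg_param x y; rewrite (seg_image pa); have [ca _ _ _] := pa.
by apply: connected_continuous_connected;
  [exact: segment_connected|exact: continuous_subspaceT].
Qed.

(** [seg x y] is connected and covered by the closed sets [seg o x] and
    [seg o y], both of which it meets. *)
Lemma meet_exists (o x y : X) : exists m, [/\ seg o x m, seg o y m & seg x y m].
Proof.
apply: contrapT => nm.
have nxy z : seg x y z -> seg o x z -> ~ seg o y z.
  by move=> ? ? ?; apply: nm; exists z; split.
have E : seg x y `&` seg o x = seg x y.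
  apply: seg_connected.
  - by exists x; split; [exact: seg_left|exact: seg_right].
  - exists (~` seg o y); first exact: closed_openC (@seg_closed o y).
    apply/seteqP; split=> z [xyz]; first by move=> oxz; split=> //; exact: nxy.
    move=> noy; split=> //; have [|//] := @seg_tri x o y z xyz.
    by rewrite segC.
  - by exists (seg o x) => //; exact: seg_closed.
have [yxy yox] : (seg x y `&` seg o x) y by rewrite E; exact: seg_right.
exact: nxy yxy yox (seg_right o y).
Qed.

Lemma seg_sub (x y z : X) : seg x y z -> seg x z `<=` seg x y /\ seg z y `<=` seg x y.
Proof.
have [a pa] := seg_param x y; rewrite (seg_image pa) => -[t /= + <-].
have [ca <- <- H] := pa; rewrite in_itv /= => /andP[t0 t1].
rewrite !H//; split=> _ [u /= + <-]; rewrite in_itv /= => /andP[? ?];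
  by exists u => //=; rewrite in_itv /=; apply/andP; split; lra.
Qed.

Definition rho (x y : X) : R :=
  sup [set mdist p.1 p.2 | p in seg x y `*` seg x y].

Lemma rho_has_sup x y : has_sup [set mdist p.1 p.2 | p in seg x y `*` seg x y].
Proof.
split; first by exists (mdist x x), (x, x) => //; split; exact: seg_left.
have [M XM] := compact_dist_bounded cX.
by exists M => _ [p _ <-].
Qed.

Lemma le_rho x y p q : seg x y p -> seg x y q -> mdist p q <= rho x y.
Proof.
move=> xp xq; apply: ub_le_sup; first exact: (rho_has_sup x y).2.
by exists (p, q).
Qed.

Lemma rho_le x y e : (forall p q, seg x y p -> seg x y q -> mdist p q <= e) ->
  rho x y <= e.
Proof.
move=> H; apply: ge_sup; first exact: (rho_has_sup x y).1.
by move=> _ [[p q] /= [? ?] <-]; exact: H.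
Qed.

Lemma rho_mono x y u v : seg u v `<=` seg x y -> rho u v <= rho x y.
Proof. by move=> H; apply: rho_le => p q /H ? /H ?; exact: le_rho. Qed.

Lemma mdist_le_rho x y : mdist x y <= rho x y.
Proof. by apply: le_rho; [exact: seg_left|exact: seg_right]. Qed.

Lemma rho_tri x z y : rho x y <= rho x z + rho z y.
Proof.
have rho0 u v : 0 <= rho u v by apply: le_trans (mdist_le_rho u v); exact: mdist_ge0.
apply: rho_le => p q /(@seg_tri x z y)[] Hp /(@seg_tri x z y)[] Hq.
- by rewrite -[leLHS]addr0 lerD// le_rho.
- apply: le_trans (metric_triangle p z q) _.
  by apply: lerD; apply: le_rho => //; [exact: seg_right|exact: seg_left].
- apply: le_trans (metric_triangle p z q) _; rewrite addrC.
  by apply: lerD; apply: le_rho => //; [exact: seg_right|exact: seg_left].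
- by rewrite -[leLHS]add0r lerD// le_rho.
Qed.

Lemma rho_le_mdist : doubling X -> bounded_turning X ->
  exists2 C : R, 0 < C & forall x y, rho x y <= C * mdist x y.
Proof.
move=> dX bX; have [C C0 HC] := short_path cX dX bX.
exists (2 * C); first by rewrite mulr_gt0.
move=> x y; have [g [cg g0 g1 gC]] := HC x y.
have segC' p : seg x y p -> mdist x p <= C * mdist x y.
  by rewrite -g0 -g1 => /(path_covers_seg cg)[t _ <-]; rewrite g0 g1.
apply: rho_le => p q /segC' xp /segC' xq.
have := metric_triangle p x q; rewrite (metric_sym p x); lra.
Qed.

End Segments.

(** * An online controller for functions along a sequence of points *)

(** The state of the controller after reading some points. At level m, the
    current m-step began at index [start m], where the function had the value
    [base m]; its direction is [down m]. [value] is the last value assigned. *)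
Record controller (R : realType) := Controller {
  value : R; start : nat -> nat; base : nat -> R; down : nat -> bool }.

Section Control.
Context {R : realType}.
Variable h : R.

Definition scale m : R := h * 8 ^+ m.

(** The m-step ends at i when the steps of all lower levels end there and the
    distance covered has reached [scale m]. This makes the steps nested.
    Every index ends a 0-step. *)
Definition restarts (r : nat -> nat -> R) i (c : controller R) m : bool :=
  all (fun l => scale l.+1 <= r (start c l.+1) i) (iota 0 m).

(** Reading the next point moves the value by the distance covered, in the
    direction of the 0-step. Then the steps of levels at most p end, and p is
    the largest such level. Their successors all receive the same direction,
    chosen by the (p+1)-step that is still running: its own direction, unless
    the value is so far ahead that a whole p-step the other way can be
    afforded. The margin 5 * scale p covers the loss on such a step, at most
    3 * scale p, and the growth of the tracked distance, at most
    2 * scale p. *)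
Definition advance (r : nat -> nat -> R) i (c : controller R) :=
  let v := value c + (-1) ^+ down c 0 * r i i.+1 in
  let p := xget 0%N [set p | restarts r i.+1 c p /\ ~~ restarts r i.+1 c p.+1] in
  let d := if (-1) ^+ down c p.+1 * (v - base c p.+1) <
              r (start c p.+1) i.+1 + 5 * scale p
           then down c p.+1 else ~~ down c p.+1 in
  let rs := restarts r i.+1 c in
  {| value := v;
     start := fun m => if rs m then i.+1 else start c m;
     base := fun m => if rs m then v else base c m;
     down := fun m => if rs m then d else down c m |}.

Definition control (r : nat -> nat -> R) i : controller R :=
  iteri i (advance r) (Controller 0 (fun=> 0%N) (fun=> 0) (fun=> false)).

Lemma scaleS m : scale m.+1 = 8 * scale m.
Proof. by rewrite /scale exprS; ring. Qed.

Lemma restarts_le r i c m k : (k <= m)%N -> restarts r i c m -> restarts r i c k.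
Proof.
move=> km /allP rm; apply/allP => l; rewrite mem_iota add0n => lk.
by apply: rm; rewrite mem_iota add0n (leq_trans lk).
Qed.

Lemma restartsS r i c m :
  restarts r i c m.+1 = restarts r i c m && (scale m.+1 <= r (start c m.+1) i).
Proof. by rewrite /restarts -[in LHS]addn1 iotaD all_cat /= add0n andbT. Qed.

Lemma start_le r m i : (start (control r i) m <= i)%N.
Proof. by elim: i => //= i IH; case: ifP => // _; exact: leqW. Qed.

(** This makes values on different rays agree on their common part. *)
Lemma eq_control r r' n : (forall i j, (i <= j <= n)%N -> r i j = r' i j) ->
  forall i, (i <= n)%N -> control r i = control r' i.
Proof.
move=> rr' ; elim=> // i IH ni; rewrite /control /= -!/(control _ _).
rewrite -(IH (ltnW ni)).
have rs m : restarts r i.+1 (control r i) m = restarts r' i.+1 (control r i) m.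
  by apply: eq_all => l; rewrite rr'// ni leqW ?start_le.
rewrite /advance rr' ?leqnSn ?ni//.
have -> : restarts r i.+1 (control r i) = restarts r' i.+1 (control r i).
  by apply/funext.
by rewrite rr'// ni leqW ?start_le.
Qed.

Variable r : nat -> nat -> R.
Hypothesis h0 : 0 < h.
Hypothesis rii : forall i, r i i = 0.
Hypothesis rle : forall i i' j' j, (i <= i')%N -> (i' <= j')%N -> (j' <= j)%N ->
  r i' j' <= r i j.
Hypothesis rtri : forall i j k, (i <= j)%N -> (j <= k)%N -> r i k <= r i j + r j k.
Hypothesis rstep : forall i, r i i.+1 <= 2 * h.

Local Notation F i := (value (control r i)).
Local Notation U m i := (start (control r i) m).
Local Notation S m i := (down (control r i) m).

Lemma scale_gt0 m : 0 < scale m.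
Proof. by rewrite /scale mulr_gt0// exprn_gt0. Qed.

Lemma r_ge0 i j : (i <= j)%N -> 0 <= r i j.
Proof. by move=> ij; rewrite -(rii i); exact: rle. Qed.

Lemma startS m i : U m i.+1 =
  if restarts r i.+1 (control r i) m then i.+1 else U m i.
Proof. by []. Qed.

Lemma start0 i : U 0%N i = i.
Proof. by case: i. Qed.

Lemma start_levels m i : (U m.+1 i <= U m i)%N.
Proof.
elim: i => //= i IH.
case: ifP => [rs|_]; first by rewrite (restarts_le (leqnSn m) rs).
by case: ifP => // _; exact: leqW (start_le _ _ _).
Qed.

Lemma base_start m i : base (control r i) m = F (U m i).
Proof. by elim: i => //= i IH; case: ifP. Qed.

Lemma start_const m j t : (U m j <= t)%N -> (t <= j)%N -> U m t = U m j.
Proof.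
elim: j => [|j IH].
  by move=> _; rewrite leqn0 => /eqP ->.
rewrite [U m j.+1]startS; case: ifP => [rs tj jt|rs ut].
  have -> : t = j.+1 by apply/eqP; rewrite eqn_leq tj jt.
  by rewrite startS rs.
rewrite leq_eqVlt => /predU1P[->|]; first by rewrite startS rs.
by rewrite ltnS; exact: IH.
Qed.

Lemma start_cut m i : U m i.+1 = i.+1 -> restarts r i.+1 (control r i) m.
Proof.
rewrite startS; case: ifP => // _ E.
by have := start_le r m i; rewrite E ltnn.
Qed.

(** The index j may be the end of the m-step that starts at v: the bounds below
    are needed there too. *)
Definition during m v j := (v <= j)%N /\ forall t, (v <= t < j)%N -> U m t = v.

Lemma during_start m j i : (U m j <= i)%N -> (i <= j.+1)%N -> during m (U m j) i.
Proof.
move=> ui ij; split=> // t /andP[ut ti]; apply: start_const => //.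
by rewrite -ltnS (leq_trans ti ij).
Qed.

Lemma during_le m v i j : during m v j -> (v <= i)%N -> (i <= j)%N -> during m v i.
Proof.
by move=> [_ H] vi ij; split=> // t /andP[vt ti]; rewrite H// vt (leq_trans ti ij).
Qed.

Lemma down_const m v j t : during m v j -> (v <= t < j)%N -> S m t = S m v.
Proof.
move=> [_ H]; elim: t => [|t IH] /andP[vt tj].
  by move: vt; rewrite leqn0 => /eqP ->.
move: vt; rewrite leq_eqVlt => /predU1P[->//|vt]; rewrite -IH; last first.
  by rewrite -ltnS vt ltnW.
rewrite /=; case: ifP => // rs; have := H t.+1; rewrite tj leqW// => /(_ isT).
by rewrite startS rs => E; move: vt; rewrite -E ltnn.
Qed.

Lemma during0 v j : during 0 v j -> j = v \/ j = v.+1.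
Proof.
move=> [vj H]; have [E|] := leqP j v.+1; first by lia.
move=> vj1; have := H v.+1; rewrite leqnSn vj1 => /(_ isT).
by rewrite start0 => /eqP; rewrite eqn_leq ltnn.
Qed.

(** The decision in terms of the two levels m and m+1 only, whichever levels
    end at v: if the (m+1)-step ends there too, the value is not ahead and the
    direction is inherited. *)
Lemma turn m v : U m v = v -> S m v =
  if (-1) ^+ S m.+1 v * (F v - F (U m.+1 v)) < r (U m.+1 v) v + 5 * scale m
  then S m.+1 v else ~~ S m.+1 v.
Proof.
case: v => [_|i /start_cut rm].
  by rewrite /= subrr mulr0 rii add0r mulr_gt0 ?scale_gt0.
rewrite [U m.+1 i.+1]startS.
set c := control r i.
have -> : S m.+1 i.+1 = (if restarts r i.+1 c m.+1 then S m i.+1 else S m.+1 i).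
  by rewrite /= -/c rm; case: ifP.
case: (boolP (restarts r i.+1 c m.+1)) => [rm1|nrm].
  by rewrite subrr mulr0 rii add0r mulr_gt0 ?scale_gt0.
rewrite {1}/control/= -!/(control _ _) -/c rm -base_start.
suff -> : xget 0%N [set p | restarts r i.+1 c p /\ ~~ restarts r i.+1 c p.+1] = m by [].
apply: (@xget_unique _ _ _ m) => [|p [rp nrp]] /=; first by rewrite rm nrm.
apply/eqP; rewrite eqn_leq; apply/andP; split; rewrite leqNgt; apply/negP => lt.
  by rewrite (restarts_le lt) in nrm.
by rewrite (restarts_le lt rm) in nrp.
Qed.

(** The last of the m-steps that make up a running (m+1)-step begins at w. As w
    did not end the (m+1)-step, r v w is bounded. *)
Lemma last_cut m v j : during m.+1 v j -> (v < j)%N ->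
  exists2 w, [/\ (v <= w < j)%N, during m w j & U m w = w] &
     (v < w)%N -> r v w < scale m.+1.
Proof.
case: j => // j [vj H] vj'; exists (U m j).
  have := H j; rewrite ltnSn andbT => /(_ vj') E.
  split; first by rewrite -{1}E start_levels ltnS start_le.
    by apply: during_start => //; exact: leqW (start_le _ _ _).
  by apply: start_const => //; exact: start_le.
have wj := start_le r m j; have ww := start_const (leqnn _) wj.
move: (start (control r j) m) wj ww => [//|w] wj ww vw.
have := start_cut ww; have := H w.+1; rewrite (ltnW vw) ltnS wj => /(_ isT).
have := H w; rewrite -ltnS vw (leq_trans wj)// => /(_ isT) Uw.
rewrite startS => + rm; case: ifP => [_ E|].
  by move: vw; rewrite -E ltnn.
by rewrite restartsS rm/= Uw leNgt => /negbFE.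
Qed.

Lemma during_length m v j : during m v j -> r v j <= 2 * scale m.
Proof.
elim: m v j => [|m IH] v j Dj.
  have := h0; have := rstep v; have := during0 Dj.
  by rewrite /scale expr0 => -[] ->; rewrite ?rii; lra.
have := Dj.1; rewrite leq_eqVlt => /predU1P[->|vj].
  by rewrite rii mulr_ge0// ltW ?scale_gt0.
have [w [/andP[vw wj] Dw _] rvw] := last_cut Dj vj.
have rvw' : r v w <= scale m.+1.
  move: vw rvw; rewrite leq_eqVlt => /predU1P[-> _|vw /(_ vw)/ltW//].
  by rewrite rii ltW ?scale_gt0.
have := IH _ _ Dw; have := rtri vw (ltnW wj); move: rvw'.
by rewrite scaleS; have := scale_gt0 m; lra.
Qed.

(** Induction on the level. On an upward (m+1)-step started at v, consider its
    last m-step, started at w. If it goes up, f gains at least r w j, hence at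
    least the increase of r v; the excess was below 5 * scale m at w and grows
    by at most 3 * scale m, which makes scale m.+1 and explains the ratio 8.
    If it goes down, f loses at most 3 * scale m while r v grows by at most
    2 * scale m, and the margin 5 * scale m absorbs both. *)
Lemma tracking m v j : during m v j ->
  r v j <= (-1) ^+ S m v * (F j - F v) <= r v j + scale m.
Proof.
elim: m v j => [|m IH] v j Dj.
  have [->|->] := during0 Dj.
    by rewrite subrr mulr0 rii add0r lexx ltW ?scale_gt0.
  by rewrite /= addrC addKr signrMK lexx lerDl ltW ?scale_gt0.
elim/ltn_ind: j Dj => j IHj Dj.
have := Dj.1; rewrite leq_eqVlt => /predU1P[->|vj].
  by rewrite subrr mulr0 rii add0r lexx ltW ?scale_gt0.
have [w [/andP[vw wj] Dw Uw] _] := last_cut Dj vj.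
have := IHj _ wj (during_le Dj vw (ltnW wj)).
have := IH _ _ Dw; rewrite (turn Uw).
have -> : U m.+1 w = v by apply: Dj.2; rewrite vw.
rewrite (down_const Dj (t := w)) ?vw//.
have := during_length Dw; have := rtri vw (ltnW wj); have := rle (leqnn v) vw (ltnW wj).
have := r_ge0 (ltnW wj); have := scale_gt0 m; rewrite scaleS.
set x := F j; set y := F w; set z := F v; set a := r v j; set b := r v w; set c := r w j.
set H := scale m.
case: (S m.+1 v); rewrite /= ?expr1 ?expr0 ?mul1r ?mulN1r => H0 c0 ba abc c2;
  case: ltP => /=; rewrite ?expr1 ?expr0 ?mul1r ?mulN1r => ? /andP[? ?] /andP[? ?];
  apply/andP; split; lra.
Qed.

Lemma scale_between x : h <= x -> exists m, scale m <= x < scale m.+1.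
Proof.
move=> hx.
have ex : exists m, x < scale m.
  exists (Num.bound (x / h)); rewrite /scale mulrC -ltr_pdivrMr//.
  have := archi_boundP (divr_ge0 (le_trans (ltW h0) hx) (ltW h0)).
  move=> /lt_le_trans; apply; rewrite -natrX ler_nat ltnW// ltn_expl//.
case: (ex_minnP ex) => -[|m]; first by rewrite /scale expr0 mulr1 ltNge hx.
move=> xm mmin; exists m; rewrite xm andbT leNgt; apply/negP => /mmin.
by rewrite ltnn.
Qed.

Variable n : nat.
Hypothesis rlarge : forall i, (i < n)%N -> h <= r i i.+1.

Lemma full_step m v j : (v < j <= n)%N -> during m v j -> U m j = j ->
  scale m <= r v j.
Proof.
case: j => // j /andP[vj jn] Dj /start_cut.
case: m Dj => [|m] Dj.
  case: (during0 Dj) => [E|[E]]; first by move: vj; rewrite -E ltnn.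
  by rewrite /scale expr0 mulr1 E rlarge// -E.
rewrite restartsS => /andP[_]; suff -> : start (control r j) m.+1 = v by [].
by apply: Dj.2; rewrite ltnSn andbT -ltnS.
Qed.

Lemma tracking_abs m v j : during m v j -> `|F j - F v| <= 3 * scale m.
Proof.
move=> D; have := tracking D; have := during_length D; have := r_ge0 D.1.
have := scale_gt0 m; rewrite ler_norml.
by case: (S m v); rewrite ?expr1 ?expr0 ?mul1r ?mulN1r => ? ? ? /andP[? ?]; lra.
Qed.

(** Two m-steps beginning in ]i, j] would begin at distance at least [scale m]
    from each other, so i and j lie in one m-step or in two consecutive ones. *)
Lemma control_lipschitz_scale m i j : (i <= j <= n)%N -> r i j < scale m ->
  `|F j - F i| <= 9 * scale m.
Proof.
move=> /andP[ij jn] rij; have sm := scale_gt0 m.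
pose v := U m j; have vj : (v <= j)%N by exact: start_le.
have [vi|iv] := leqP v i.
  have := tracking_abs (during_start vi (leqW ij)).
  have := tracking_abs (during_start vj (leqnSn j)).
  by rewrite !ler_norml => /andP[? ?] /andP[? ?]; lra.
have Dv : during m v j by apply: during_start.
have Uv : U m v = v by apply: start_const.
case: v vj iv Dv Uv => // v vj iv Dv Uv.
pose w := U m v; have wv : (w <= v)%N by exact: start_le.
have Dw : during m w v.+1 by apply: during_start => //; exact: leqW.
have rw : scale m <= r w v.+1.
  by apply: full_step => //; rewrite ltnS wv/= (leq_trans vj).
have wi : (w <= i)%N.
  rewrite leqNgt; apply/negP => /ltnW iw; move: rij; rewrite ltNge => /negP; apply.
  by rewrite (le_trans rw)// rle// leqW.
have := tracking_abs Dv; have := tracking_abs Dw.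
have := tracking_abs (during_le Dw wi (ltnW iv)).
by rewrite !ler_norml => /andP[? ?] /andP[? ?] /andP[? ?]; lra.
Qed.

Lemma control_lipschitz i j : (i <= j <= n)%N -> `|F j - F i| <= 72 * r i j.
Proof.
move=> /andP[]; rewrite leq_eqVlt => /predU1P[-> _|ij jn].
  by rewrite subrr normr0 rii mulr0.
have hr : h <= r i j.
  by rewrite (le_trans (rlarge (leq_trans ij jn)))// rle.
have [m /andP[m1 m2]] := scale_between hr.
have ij' : (i <= j <= n)%N by rewrite ltnW.
by have := control_lipschitz_scale ij' m2; rewrite scaleS; lra.
Qed.

(** Between i and j there is a whole m-step: otherwise r i j is at most the
    length of two m-steps. *)
Lemma control_oscillates i j : (i <= j <= n)%N -> 5 * h <= r i j ->
  exists a b, [/\ (i <= a)%N, (a <= b)%N, (b <= j)%N & r i j <= 40 * `|F b - F a|].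
Proof.
move=> /andP[ij jn] rij.
have [|m /andP[m1 m2]] := @scale_between (r i j / 5).
  by rewrite ler_pdivlMr// mulrC.
have sm := scale_gt0 m; rewrite scaleS in m2.
pose w := U m j; have wj : (w <= j)%N by exact: start_le.
have Dw : during m w j by apply: during_start.
have Uw : U m w = w by apply: start_const.
have rwj := during_length Dw.
have [wi|iw] := leqP w i.
  by have := rle wi ij (leqnn j); lra.
case: w wj Dw Uw rwj iw => // w wj Dw Uw rwj iw.
pose v := U m w; have wv : (v <= w)%N by exact: start_le.
have Dv : during m v w.+1 by apply: during_start => //; exact: leqW.
have rv : scale m <= r v w.+1.
  by apply: full_step => //; rewrite ltnS wv/= (leq_trans wj).
have [iv|vi] := leqP i v.
  exists v, w.+1; split=> //; first exact: leqW.
  have /andP[+ _] := tracking Dv.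
  have : (-1) ^+ S m v * (F w.+1 - F v) <= `|F w.+1 - F v|.
    by rewrite (le_trans (ler_norm _))// normrM normrX normrN1 expr1n mul1r.
  by lra.
have := rle (ltnW vi) (ltnW iw) (leqnn w.+1); have := during_length Dv.
by have := rtri (ltnW iw) wj; lra.
Qed.

End Control.

(** * Rays from a root and the zigzag function at a fixed mesh *)

Lemma dist_common (R : realType) (a b c d e : R) :
  `|a - b| <= d -> `|c - b| <= e -> `|a - c| <= d + e.
Proof.
move=> ab cb; apply: le_trans (ler_distD b _ _) _.
by rewrite lerD// distrC.
Qed.

Lemma dist_perturb (R : realType) (a b c d e : R) :
  `|a - c| <= e -> `|b - d| <= e -> `|a - b| <= `|c - d| + 2 * e.
Proof.
move=> ac bd; have := ler_distD c a b; have := ler_distD d c b.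
by rewrite (distrC d b); lra.
Qed.

Section Rays.
Context {R : realType} {X : metricType R}.
Hypothesis cX : compact [set: X].
Implicit Types x y z v w p q m : X.
Hypothesis arcX : forall u v : X, u <> v -> exists! A : set X, jordan_arc u v A.
Variable C : R.
Hypothesis C0 : 0 < C.
Hypothesis rhoC : forall x y, rho x y <= C * mdist x y.
Variable o : X.
Variable h : R.
Hypothesis h0 : 0 < h.

Definition succ v w := [/\ seg o w v, h <= mdist v w &
  forall y, seg v w y -> y <> w -> mdist v y < h].

Definition next_vertex x v := xget v [set w | seg o x w /\ succ v w].

Definition vertex x i := iter i (next_vertex x) o.

(** The earlier of w and w' on the ray is already at distance h from v. *)
Lemma succ_uniq x v w w' : seg o x w -> seg o x w' -> succ v w -> succ v w' -> w = w'.
Proof.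
have [a pa] := seg_param arcX o x; rewrite (seg_image pa).
move=> [t t01 <-] [t' t'01 <-] {w w'}; have [_ a0 _ H] := pa.
wlog tt' : t t' t01 t'01 / t <= t'.
  move=> W; have [|/ltW] := leP t t'; first exact: W.
  by move=> le sw sw'; apply/esym; exact: W.
move: t01 t'01; rewrite /= !in_itv /= => /andP[t0 t1] /andP[t'0 t'1].
move=> [ov hv _] [_ _ H']; apply: contrapT => ne.
move: ov; rewrite -a0 H// => -[s /= +  sv]; rewrite in_itv /= => /andP[s0 st].
suff /H'/(_ ne) : seg v (a t') (a t) by rewrite ltNge hv.
rewrite -sv H// ?(le_trans st)//; exists t => //=.
by rewrite in_itv /= st.
Qed.

Lemma next_vertexP x v : next_vertex x v = v \/
  seg o x (next_vertex x v) /\ succ v (next_vertex x v).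
Proof. by rewrite /next_vertex; case: xgetP => [w -> //|_]; [right|left]. Qed.

Lemma next_vertexE x v w : seg o x w -> succ v w -> next_vertex x v = w.
Proof.
move=> xw vw; rewrite /next_vertex; case: xgetP => [w' _ [xw' vw']|/(_ w)[]//].
exact: succ_uniq xw' xw vw' vw.
Qed.

(** The next vertex is at the first time after s at which the distance to a s
    reaches h. *)
Lemma next_vertex_position x a s : parametrizes a o x -> 0 <= s <= 1 ->
  exists t, [/\ s <= t <= 1, next_vertex x (a s) = a t,
    forall u, s <= u <= t -> mdist (a s) (a u) <= h &
    succ (a s) (a t) \/
    t = s /\ forall u, s <= u <= 1 -> mdist (a s) (a u) < h].
Proof.
move=> pa /andP[s0 s1]; have [ca a0 a1 H] := pa.
have [far|near] := pselect (exists2 u, s <= u <= 1 & h <= mdist (a s) (a u)); last first.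
  have {}near u : s <= u <= 1 -> mdist (a s) (a u) < h.
    by move=> su; rewrite ltNge; apply/negP => hu; apply: near; exists u.
  exists s; split; [by rewrite lexx| | |by right].
    have [//|[]] := next_vertexP x (a s).
    set w := next_vertex _ _; rewrite (seg_image pa) => -[t' /= + <-].
    rewrite in_itv /= => /andP[t'0 t'1] [ov hv _].
    have [st'|t's] := leP s t'; first by have := near t'; rewrite st' t'1 ltNge hv => /(_ isT).
    move: ov; rewrite -a0 H// => -[s' /=]; rewrite in_itv /= => /andP[s'0 s't'] E.
    have : seg (a s') (a s) (a t').
      rewrite H// ?(le_trans s't' (ltW t's))//; exists t' => //=.
      by rewrite in_itv /= s't' ltW.
    by rewrite E segxx => -> .
  move=> u /andP[su us]; have -> : u = s by apply/eqP; rewrite eq_le us.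
  by rewrite mdistxx ltW.
pose T := [set u | s <= u <= 1 /\ h <= mdist (a s) (a u)].
have T0 : T !=set0 by case: far => u ? ?; exists u.
have Tlb : has_lbound T by exists s => u [/andP[]].
pose t := inf T.
have st : s <= t by apply: lb_le_inf => // u [/andP[]].
have tT u : T u -> t <= u by move=> Tu; exact: ge_inf.
have t1 : t <= 1.
  by case: far => u su hu; apply: (@le_trans _ _ u); [exact: tT|case/andP: su].
have t0 : 0 <= t by exact: le_trans st.
have before u : s <= u -> u < t -> mdist (a s) (a u) < h.
  move=> su ut; rewrite ltNge; apply/negP => hu.
  have : t <= u by apply: tT; split=> //; rewrite su (le_trans (ltW ut)).
  by rewrite leNgt ut.
have /continuous_mdistP ca' := ca.
(* The distance is exactly h at the first time t. *)
have ht : h <= mdist (a s) (a t).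
  rewrite leNgt; apply/negP => lt.
  have [d d0 ad] := ca' t (h - mdist (a s) (a t)) ltac:(by rewrite subr_gt0).
  have [|u Tu ud] := @inf_lt _ T (t + d) T0; first by rewrite ltrDl.
  have tu := tT _ Tu; have [_ hu] := Tu.
  have /ad : `|t - u| < d by rewrite ler0_norm; lra.
  have := metric_triangle (a s) (a t) (a u); lra.
have th : mdist (a s) (a t) <= h.
  apply/ler_addgt0Pl => e e0; have [d d0 ad] := ca' t e e0.
  move: st; rewrite le_eqVlt => /predU1P[<-|lt].
    by rewrite mdistxx addr_ge0// ltW.
  pose u := Num.max s (t - d / 2).
  have su : s <= u by rewrite le_max lexx.
  have ut : u < t by rewrite gt_max lt; lra.
  have ud : t - d / 2 <= u by rewrite le_max lexx orbT.
  have := before _ su ut; have : mdist (a t) (a u) < e by apply: ad; rewrite gtr0_norm; lra.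
  rewrite metric_sym; have := metric_triangle (a s) (a u) (a t); lra.
have sat : succ (a s) (a t).
  split=> //; first by rewrite -a0 H//; exists s => //=; rewrite in_itv /= s0.
  move=> y; rewrite H// => -[u /=]; rewrite in_itv /= => /andP[su ut] <- ne.
  apply: before => //; rewrite lt_neqAle ut andbT.
  by apply/eqP => E; apply: ne; rewrite E.
exists t; split; [by rewrite st| | |by left].
  apply: next_vertexE => //; rewrite (seg_image pa); exists t => //=.
  by rewrite in_itv /= t0.
move=> u /andP[su]; rewrite le_eqVlt => /predU1P[->//|ut].
exact/ltW/before.
Qed.

Lemma vertex_positions x a : parametrizes a o x -> exists t : nat -> R,
  [/\ forall i, vertex x i = a (t i),
      forall i j, (i <= j)%N -> t i <= t j &
      forall i, 0 <= t i <= 1].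
Proof.
move=> pa; have /choice[f fP] s : exists t, 0 <= s <= 1 ->
    s <= t <= 1 /\ next_vertex x (a s) = a t.
  have [s01|ns] := pselect (0 <= s <= 1 : Prop); last by exists 0.
  by have [t [? ? _ _]] := next_vertex_position pa s01; exists t.
have t01 i : 0 <= iter i f 0 <= 1.
  elim: i => /= [|i IH]; first by rewrite lexx ler01.
  by have [/andP[? ?] _] := fP _ IH; apply/andP; split=> //; lra.
exists (fun i => iter i f 0); split=> //.
  elim=> /= [|i IH]; first by have [_ <-] := pa.
  by rewrite IH; have [_ ->] := fP _ (t01 i).
move=> i j /subnKC <-; elim: (j - i)%N => [|k IH]; first by rewrite addn0.
by rewrite addnS; apply: le_trans IH _; have [/andP[]] := fP _ (t01 (i + k)%N).
Qed.

Lemma vertex_seg x i : seg o x (vertex x i).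
Proof.
have [a pa] := seg_param arcX o x; have [t [tv _ t01]] := vertex_positions pa.
by rewrite tv (seg_image pa); exists (t i) => //=; rewrite in_itv /= t01.
Qed.

Lemma vertex_rho_le x i i' j' j : (i <= i')%N -> (i' <= j')%N -> (j' <= j)%N ->
  rho (vertex x i') (vertex x j') <= rho (vertex x i) (vertex x j).
Proof.
move=> ii' i'j' j'j; apply: rho_mono => //.
have [a pa] := seg_param arcX o x; have [t [tv tm t01]] := vertex_positions pa.
rewrite !tv; have [_ _ _ H] := pa.
have le := (tm _ _ i'j', tm _ _ ii', tm _ _ j'j).
have := t01 i; have := t01 j => /andP[? ?] /andP[? ?].
have [[i'j'' ii''] jj''] := le.
rewrite !H; try lra.
move=> _ [u /= + <-]; rewrite in_itv /= => /andP[? ?]; exists u => //=.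
by rewrite in_itv /=; apply/andP; split; lra.
Qed.

Lemma vertex_step x i : rho (vertex x i) (vertex x i.+1) <= 2 * h.
Proof.
have [a pa] := seg_param arcX o x; have [t [tv tm t01]] := vertex_positions pa.
have [t' [/andP[tt' t'1] E near _]] := next_vertex_position pa (t01 i).
rewrite /vertex iterS -/(vertex x i) tv E.
have [_ _ _ H] := pa; have /andP[t0 t1] := t01 i.
have near' p : seg (a (t i)) (a t') p -> mdist (a (t i)) p <= h.
  by rewrite H// => -[u /=]; rewrite in_itv /= => /near + <-.
apply: (rho_le cX) => p q /near' Hp /near' Hq.
by have := metric_triangle p (a (t i)) q; rewrite (metric_sym p (a (t i))); lra.
Qed.

Lemma vertex_far x i : vertex x i.+1 != vertex x i -> h <= rho (vertex x i) (vertex x i.+1).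
Proof.
move=> /eqP ne; have [//|[_ [_ hv _]]] := next_vertexP x (vertex x i).
exact: le_trans hv (mdist_le_rho cX arcX _ _).
Qed.

(** Distinct vertices of a ray are at distance at least h / C, because
    [rho] is monotone along the ray; in a compact space they are finitely
    many. *)
Lemma vertex_stops x : exists i, vertex x i.+1 == vertex x i.
Proof.
apply: contrapT => nstop.
have far i j : (i < j)%N -> h / C <= mdist (vertex x i) (vertex x j).
  move=> ij; rewrite ler_pdivrMr// mulrC.
  apply: le_trans (rhoC _ _); apply: (@le_trans _ _ (rho (vertex x i) (vertex x i.+1))).
    by apply: vertex_far; apply/negP => E; apply: nstop; exists i.
  exact: vertex_rho_le.
have [q [_ clq]] := cX (F := vertex x @ \oo) _ filterT.
have hC : 0 < h / C / 2 by rewrite !divr_gt0.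
have near k : exists2 j, (k <= j)%N & mdist q (vertex x j) < h / C / 2.
  have /clq - /(_ (ball q (h / C / 2))) :
      (vertex x @ \oo) [set y | exists2 j, (k <= j)%N & y = vertex x j].
    by exists k => // j /= kj; exists j.
  case; first exact: nbhsx_ballx.
  by move=> _ [[j kj ->]]; rewrite ballEmdist => jq; exists j.
have [i _ qi] := near 0%N; have [j ij qj] := near i.+1.
have := far _ _ ij; have := metric_triangle (vertex x i) q (vertex x j).
by rewrite (metric_sym _ q); lra.
Qed.

Definition nb_vertices x := ex_minn (vertex_stops x).

Lemma vertex_stop x : vertex x (nb_vertices x).+1 = vertex x (nb_vertices x).
Proof. by rewrite /nb_vertices; case: ex_minnP => i /eqP. Qed.

Lemma vertex_moves x i : (i < nb_vertices x)%N -> vertex x i.+1 != vertex x i.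
Proof.
rewrite /nb_vertices; case: ex_minnP => m _ mmin; rewrite ltnNge.
by apply: contra => /mmin.
Qed.

Lemma last_vertex_near x : rho (vertex x (nb_vertices x)) x <= 2 * h.
Proof.
have [a pa] := seg_param arcX o x; have [t [tv tm t01]] := vertex_positions pa.
set n := nb_vertices x.
have [t' [_ E _ succ_or]] := next_vertex_position pa (t01 n).
have {succ_or} [[_ hv _]|[_ near]] := succ_or.
  move: hv; rewrite -E -tv -[next_vertex _ _]/(vertex x n.+1) vertex_stop mdistxx.
  by rewrite leNgt h0.
have [_ _ a1 H] := pa; have /andP[t0 t1] := t01 n.
have near' p : seg (vertex x n) x p -> mdist (a (t n)) p <= h.
  by rewrite tv -{1}a1 H// => -[u /=]; rewrite in_itv /= => /near/ltW + <-.
apply: (rho_le cX) => p q /near' Hp /near' Hq.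
by have := metric_triangle p (a (t n)) q; rewrite (metric_sym p (a (t n))); lra.
Qed.

Lemma vertex_prefix x m i : seg o x m -> (i <= nb_vertices m)%N ->
  vertex m i = vertex x i.
Proof.
move=> xm; elim: i => // i IH im.
have /eqP ne := vertex_moves im; have E := IH (ltnW im).
rewrite [RHS]/(next_vertex x (vertex x i)) -E; apply/esym.
have [//|[mw vw]] := next_vertexP m (vertex m i).
apply: next_vertexE => //.
by apply: (seg_sub arcX xm).1.
Qed.

Lemma nb_vertices_le x m : seg o x m -> (nb_vertices m <= nb_vertices x)%N.
Proof.
move=> xm; rewrite leqNgt; apply/negP => lt.
have := vertex_moves lt; rewrite !(vertex_prefix xm)//; last exact: ltnW.
by rewrite vertex_stop eqxx.
Qed.

(** A vertex of the ray to x inside [seg o m] would also be a vertex of the ray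
    to m. *)
Lemma vertex_beyond x m i : seg o x m -> (nb_vertices m < i <= nb_vertices x)%N ->
  seg m x (vertex x i).
Proof.
have [a pa] := seg_param arcX o x; have [t [tv tm t01]] := vertex_positions pa.
move=> xm /andP[mi ix]; have := xm; rewrite (seg_image pa) => -[s /= + sm].
rewrite in_itv /= => /andP[s0 s1]; have [_ a0 a1 H] := pa.
set k := nb_vertices m in mi.
suff st : s <= t k.+1.
  have -> : seg m x = a @` `[s, 1] by rewrite -sm -[X in seg _ X]a1 H.
  rewrite tv; exists (t i) => //=; rewrite in_itv /=.
  by rewrite (le_trans st (tm _ _ mi))/=; case/andP: (t01 i).
rewrite leNgt; apply/negP => ts.
have /eqP := vertex_moves (leq_trans mi ix); apply.
have [//|[_ vw]] := next_vertexP x (vertex x k).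
have mw : seg o m (vertex x k.+1).
  have -> : seg o m = a @` `[0, s] by rewrite -[X in seg X _]a0 -sm H.
  rewrite tv; exists (t k.+1) => //=; rewrite in_itv /= (ltW ts) andbT.
  by case/andP: (t01 k.+1).
have E : vertex m k.+1 = vertex x k.+1.
  rewrite [LHS]/(next_vertex m (vertex m k)) (vertex_prefix xm (leqnn k)).
  exact: next_vertexE.
by rewrite -E -(vertex_prefix xm (leqnn k)) vertex_stop.
Qed.

Definition vertex_rho x i j := rho (vertex x i) (vertex x j).

Definition zigzag x : R := value (control h (vertex_rho x) (nb_vertices x)).

Lemma rhoxx x : rho x x = 0.
Proof.
apply/eqP; rewrite eq_le; apply/andP; split.
  by apply: (rho_le cX) => p q; rewrite segxx => -> ->; rewrite mdistxx.
by rewrite -[leLHS](mdistxx x) mdist_le_rho.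
Qed.

Lemma rho_sym x y : rho x y = rho y x.
Proof. by rewrite /rho (segC cX arcX). Qed.

Let F x i := value (control h (vertex_rho x) i).

Lemma F_lipschitz x i j : (i <= nb_vertices x)%N -> (j <= nb_vertices x)%N ->
  `|F x j - F x i| <= 72 * rho (vertex x i) (vertex x j).
Proof.
move=> ix jx; wlog ij : i j ix jx / (i <= j)%N.
  move=> W; have [|/ltnW] := leqP i j; first exact: W.
  by move=> ji; rewrite distrC rho_sym; exact: W.
apply: (@control_lipschitz _ h (vertex_rho x) h0 _ _ _ _ (nb_vertices x)) => //.
- by move=> k; exact: rhoxx.
- exact: vertex_rho_le.
- by move=> *; exact: rho_tri.
- exact: vertex_step.
- by move=> k kx; apply: vertex_far; exact: vertex_moves.
- by rewrite ij.
Qed.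

Lemma zigzag_prefix x m : seg o x m -> zigzag m = F x (nb_vertices m).
Proof.
move=> xm; rewrite /zigzag /F (@eq_control _ h (vertex_rho m) (vertex_rho x) (nb_vertices m))//.
move=> i j /andP[ij jm]; rewrite /vertex_rho !(vertex_prefix xm)//.
exact: leq_trans jm.
Qed.

Lemma zigzag_ray x m : seg o x m ->
  `|zigzag x - zigzag m| <= 72 * (rho m x + 2 * h).
Proof.
move=> xm; rewrite (zigzag_prefix xm); have := nb_vertices_le xm.
rewrite leq_eqVlt => /predU1P[->|lt].
  rewrite subrr normr0 mulr_ge0// addr_ge0 ?mulr_ge0 ?(ltW h0)//.
  exact: le_trans (mdist_ge0 _ _) (mdist_le_rho cX arcX _ _).
apply: le_trans (F_lipschitz (ltnW lt) (leqnn _)) _.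
apply: ler_wpM2l => //; rewrite addrC.
apply: le_trans (rho_tri cX arcX _ m _) _; apply: lerD.
  by rewrite -(vertex_prefix xm)//; exact: last_vertex_near.
apply: rho_mono => //; apply: (seg_sub arcX _).1.
by apply: vertex_beyond => //; rewrite lt leqnn.
Qed.

(** Compare x and y with their median m, where the two rays separate. *)
Lemma zigzag_lipschitz x y :
  `|zigzag x - zigzag y| <= 144 * rho x y + 288 * h.
Proof.
have [m [xm ym xym]] := meet_exists cX arcX o x y.
have mx : rho m x <= rho x y.
  by rewrite rho_sym; apply: rho_mono => //; exact: (seg_sub arcX xym).1.
have my : rho m y <= rho x y.
  by apply: rho_mono => //; exact: (seg_sub arcX xym).2.
apply: le_trans (dist_common (zigzag_ray xm) (zigzag_ray ym)) _.
by move: mx my; lra.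
Qed.

Lemma zigzag_bounded x : `|zigzag x| <= 72 * rho o x.
Proof.
have := F_lipschitz (leq0n (nb_vertices x)) (leqnn _).
rewrite {2}/F subr0 => /le_trans; apply; apply: ler_wpM2l => //.
apply: rho_mono => //; apply: (seg_sub arcX _).1; exact: vertex_seg.
Qed.

Lemma F_near x i : (i <= nb_vertices x)%N -> `|F x i - zigzag (vertex x i)| <= 144 * h.
Proof.
move=> ix; have xv := vertex_seg x i; rewrite (zigzag_prefix xv).
apply: le_trans (F_lipschitz (nb_vertices_le xv) ix) _.
rewrite -(vertex_prefix xv)//.
by have := last_vertex_near (vertex x i); lra.
Qed.

Lemma zigzag_oscillates_ray x m : seg o x m -> exists p q,
  [/\ seg m x p, seg m x q & rho m x <= 40 * `|zigzag p - zigzag q| + 120 * (100 * h)].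
Proof.
move=> xm; set k := nb_vertices m; set n := nb_vertices x.
have mk : rho m (vertex x k) <= 2 * h.
  by rewrite rho_sym -(vertex_prefix xm)//; exact: last_vertex_near.
have nx : rho (vertex x n) x <= 2 * h by exact: last_vertex_near.
have trivial : rho m x <= 120 * (100 * h) -> exists p q,
    [/\ seg m x p, seg m x q & rho m x <= 40 * `|zigzag p - zigzag q| + 120 * (100 * h)].
  move=> H; exists m, m; split; [exact: seg_left|exact: seg_left|].
  by rewrite subrr normr0; lra.
have := nb_vertices_le xm; rewrite leq_eqVlt => /predU1P[E|lt].
  apply: trivial; have := rho_tri cX arcX m (vertex x k) x.
  by move: nx; rewrite /n -E -/k; have := h0; lra.
have knx : rho m x <= 6 * h + rho (vertex x k.+1) (vertex x n).
  have := rho_tri cX arcX m (vertex x k) x.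
  have := rho_tri cX arcX (vertex x k) (vertex x k.+1) x.
  have := rho_tri cX arcX (vertex x k.+1) (vertex x n) x.
  by have := vertex_step x k; lra.
have [big|small] := leP (5 * h) (rho (vertex x k.+1) (vertex x n)); last first.
  by apply: trivial; have := h0; lra.
have [||||||a [b [ka ab bn Hab]]] :=
  @control_oscillates _ h (vertex_rho x) h0 _ _ _ _ n _ k.+1 n _ big.
- by move=> i; exact: rhoxx.
- exact: vertex_rho_le.
- by move=> *; exact: rho_tri.
- exact: vertex_step.
- by move=> i ix; apply: vertex_far; exact: vertex_moves.
- by rewrite lt leqnn.
have kb : (k < b)%N by exact: leq_trans ab.
have an : (a <= n)%N by exact: leq_trans bn.
exists (vertex x b), (vertex x a); split.
- by apply: vertex_beyond => //; rewrite kb.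
- by apply: vertex_beyond => //; rewrite ka.
have ab_near := dist_perturb (F_near bn) (F_near an).
have sml : rho m x <=
    6 * h + 40 * (`|zigzag (vertex x b) - zigzag (vertex x a)| + 2 * (144 * h)).
  apply: le_trans knx _; rewrite lerD2l.
  by apply: le_trans Hab _; rewrite ler_wpM2l.
apply: le_trans sml _; rewrite mulrDr addrCA lerD2l.
by have := h0; lra.
Qed.

Lemma zigzag_oscillates x y : exists p q,
  [/\ seg x y p, seg x y q & rho x y <= 80 * `|zigzag p - zigzag q| + 240 * (100 * h)].
Proof.
have [m [xm ym xym]] := meet_exists cX arcX o x y.
have := rho_tri cX arcX x m y; rewrite (rho_sym x m) => tri.
have [le|/ltW le] := leP (rho m y) (rho m x).
  have [p [q [mp mq pq]]] := zigzag_oscillates_ray xm.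
  have sub := (seg_sub arcX xym).1; rewrite (segC cX arcX m) in mp mq.
  by exists p, q; split; [exact: sub|exact: sub|lra].
have [p [q [mp mq pq]]] := zigzag_oscillates_ray ym.
have sub := (seg_sub arcX xym).2.
by exists p, q; split; [exact: sub|exact: sub|lra].
Qed.

End Rays.

(** * Passage to the limit and Lipschitz lightness *)

Lemma ultra_limit (I : Type) (T : topologicalType) (G : set_system I) (K : set T)
    (u : I -> T) : UltraFilter G -> compact K -> (forall i, K (u i)) ->
  exists2 l, K l & forall V, nbhs l V -> G (u @^-1` V).
Proof.
move=> UG cK Ku; have [|l [Kl cl]] := cK (u @ G) _.
  by apply: (@filterE _ G) => i; exact: Ku.
exists l => // V lV; have [//|] := in_ultra_setVsetC (u @^-1` V) UG.
rewrite preimage_setC => GV; have [t [nVt Vt]] := cl _ _ GV lV.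
by [].
Qed.

Section Limit.
Context {R : realType} {X : metricType R}.
Implicit Types x y p q : X.
Hypothesis cX : compact [set: X].
Hypothesis arcX : forall u v : X, u <> v -> exists! A : set X, jordan_arc u v A.
Variable C : R.
Hypothesis C0 : 0 < C.
Hypothesis rhoC : forall x y, rho x y <= C * mdist x y.

Let step (k : nat) : R := k.+1%:R^-1.

Let step_gt0 k : 0 < step k.
Proof. by rewrite invr_gt0 ltr0n. Qed.

(** The limit of the functions [zigzag] of mesh 1 / (k+1) along a nonprincipal
    ultrafilter. The points p, q at which they oscillate on a given arc
    depend on k and converge along the ultrafilter too; the uniform Lipschitz
    bound carries the oscillation to their limits. *)
Lemma oscillating_function (o : X) : exists f : X -> R,
  (forall x y, `|f x - f y| <= 144 * C * mdist x y) /\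
  (forall x y, exists p q, [/\ seg x y p, seg x y q &
     mdist x y <= 80 * `|f p - f q|]).
Proof.
have zz k : exists z : X -> R, [/\ forall x, `|z x| <= 72 * rho o x,
    forall x y, `|z x - z y| <= 144 * rho x y + 288 * step k &
    forall x y, exists p q, [/\ seg x y p, seg x y q &
      rho x y <= 80 * `|z p - z q| + 240 * (100 * step k)]].
  exists (zigzag cX arcX C0 rhoC o (step_gt0 k)); split.
  - exact: zigzag_bounded.
  - exact: zigzag_lipschitz.
  - exact: zigzag_oscillates.
have [z zP] := choice zz.
have [G [UG ooG]] := @ultraFilterLemma nat (\oo) _.
have small e : 0 < e -> G [set k | step k < e].
  move=> e0; apply: ooG; exists (Num.bound e^-1) => // k /= ek.
  rewrite invf_plt ?posrE//.
  apply: lt_le_trans (archi_boundP _) _; first by rewrite invr_ge0 ltW.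
  by rewrite ler_nat leqW.
have lim x : exists l, forall e, 0 < e -> G [set k | `|l - z k x| < e].
  pose K : set R := `[- (72 * rho o x), 72 * rho o x]%classic.
  have [|i|l _ Hl] := @ultra_limit _ _ G K (fun k => z k x) UG.
  - exact: segment_compact.
  - by rewrite /K /= in_itv /= -ler_norml; case: (zP i).
  by exists l => e e0; exact: (Hl _ (nbhsx_ballx l e e0)).
have {lim} [f fP] := choice lim.
have C0' := ltW C0.
have rle x y : 144 * rho x y <= 144 * C * mdist x y.
  by rewrite -mulrA ler_pM2l.
have flip x y : `|f x - f y| <= 144 * C * mdist x y.
  apply/ler_addgt0Pl => e e0.
  (* The total error is 290 d: twice d for the limits, 288 d for the mesh. *)
  pose d := e / (30 * 10).
  have d0 : 0 < d by rewrite divr_gt0 ?mulr_gt0.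
  have [k [[Hx Hy] Hk]] := filter_ex (filterI (filterI (fP x d d0) (fP y d d0)) (small d d0)).
  have := dist_perturb (ltW Hx) (ltW Hy).
  have [_ /(_ x y) lip _] := zP k; move: Hk lip => /= Hk lip.
  move: (rle x y) lip Hk; move: (`|z k x - z k y|) (`|f x - f y|) (rho x y) (step k).
  by rewrite /d => a b c s *; lra.
exists f; split=> // x y.
have exP k : exists pq : X * X, [/\ seg x y pq.1, seg x y pq.2 &
    rho x y <= 80 * `|z k pq.1 - z k pq.2| + 240 * (100 * step k)].
  by have [_ _ /(_ x y)[p [q ?]]] := zP k; exists (p, q).
have [pq pqP] := choice exP.
have [|k|p sp Hp] := @ultra_limit _ _ G (seg x y) (fun k => (pq k).1) UG.
- exact: seg_compact.
- by case: (pqP k).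
have [|k|q sq Hq] := @ultra_limit _ _ G (seg x y) (fun k => (pq k).2) UG.
- exact: seg_compact.
- by case: (pqP k).
exists p, q; split=> //.
apply: le_trans (mdist_le_rho cX arcX _ _) _.
apply/ler_addgt0Pl => e e0.
(* Replacing the values at p_k and q_k by f p and f q costs (144 C + 289) d
   each, and the mesh contributes the last term. *)
pose A : R := 160 * (144 * C + 289) + 240 * 100.
have A0 : 0 < A by rewrite /A; lra.
pose d := e / A; have d0 : 0 < d by rewrite divr_gt0.
have Ad : A * d = e by rewrite /d mulrC divfK// gt_eqF.
have Gp : G [set k | mdist p (pq k).1 < d].
  by have := Hp _ (nbhsx_ballx p d d0); rewrite ballEmdist.
have Gq : G [set k | mdist q (pq k).2 < d].
  by have := Hq _ (nbhsx_ballx q d d0); rewrite ballEmdist.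
have [k [[[Kp Kq] [Fp Fq]] Kk]] := filter_ex (filterI (filterI (filterI Gp Gq)
  (filterI (fP p d d0) (fP q d d0))) (small d d0)).
have [_ lip _] := zP k; have [_ _ Hr] := pqP k.
have near w w' : mdist w w' < d -> `|f w - z k w| < d ->
    `|z k w' - f w| <= (144 * C + 289) * d.
  move=> ww' fw; rewrite distrC; apply: le_trans (ler_distD (z k w) _ _) _.
  have l1 := lip w w'; have l2 := rle w w'.
  have l3 : 144 * C * mdist w w' <= 144 * C * d.
    by rewrite ler_wpM2l ?mulr_ge0// ltW.
  move: l1 l2 l3 fw Kk => /=.
  move: (`|z k w - z k w'|) (`|f w - z k w|) (rho w w') (step k) (mdist w w') => a b c s m.
  by move=> *; lra.
have := dist_perturb (near _ _ Kp Fp) (near _ _ Kq Fq).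
move: Hr Kk Ad => /=; rewrite /A.
move: (`|z k _ - z k _|) (`|f p - f q|) (rho x y) (step k) => a b c s.
by move=> *; lra.
Qed.

End Limit.

Section Light.
Context {R : realType} {X : metricType R}.
Hypothesis cX : compact [set: X].
Hypothesis arcX : forall u v : X, u <> v -> exists! A : set X, jordan_arc u v A.
Variable C : R.
Hypothesis C0 : 0 < C.
Hypothesis rhoC : forall x y : X, rho x y <= C * mdist x y.

Lemma seg_near_chain r (x z : X) s : 0 < r -> path (close r) x s -> z \in x :: s ->
  forall w, seg x z w -> exists2 u, u \in x :: s & mdist u w <= C * r.
Proof.
move=> r0; elim: s x => [|y s IH] x /=.
  move=> _; rewrite inE => /eqP -> w; rewrite segxx => ->; exists x => //.
    by rewrite mem_head.
  by rewrite mdistxx mulr_ge0// ltW.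
move=> /andP[xy ps]; rewrite in_cons => /predU1P[->|zs] w.
  rewrite segxx => ->; exists x; first by rewrite mem_head.
  by rewrite mdistxx mulr_ge0// ltW.
move=> /(@seg_tri _ _ cX arcX x y z)[xyw|yzw].
  exists x; first by rewrite mem_head.
  apply: le_trans (le_rho cX (seg_left x y) xyw) _; apply: le_trans (rhoC _ _) _.
  by rewrite ler_pM2l.
have [u us uw] := IH _ ps zs _ yzw; exists u => //.
by rewrite in_cons us orbT.
Qed.

Lemma chain_near_seg r (x y : X) s : 0 < r -> delta_chain r s -> x \in s -> y \in s ->
  forall w, seg x y w -> exists2 u, u \in s & mdist u w <= C * r.
Proof.
case: s => // x0 s r0 ps xs ys w /(@seg_tri _ _ cX arcX x x0 y)[].
  by rewrite (segC cX arcX); exact: seg_near_chain.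
exact: seg_near_chain.
Qed.

Lemma row1_dist (a b : R) :
  mdist (const_mx a : euclidean R 1) (const_mx b : euclidean R 1) = `|a - b|.
Proof.
rewrite -sqrtr_sqr; congr Num.sqrt.
by rewrite big_ord1 !mxE.
Qed.

(** If x and y lie in one r-component, some p and q on [seg x y] satisfy
    d(x, y) <= K |f p - f q|, and both are within C r of the chain. *)
Lemma oscillating_light (f : X -> R) (L K : R) : 0 < L -> 0 < K ->
  (forall x y, `|f x - f y| <= L * mdist x y) ->
  (forall x y, exists p q, [/\ seg x y p, seg x y q & mdist x y <= K * `|f p - f q|]) ->
  lipschitz_light (fun x => const_mx (f x) : euclidean R 1).
Proof.
move=> L0 K0 fL fK; exists L, (K * (1 + 2 * (L * C))); split=> //.
- by rewrite mulr_gt0// addr_gt0// !mulr_gt0.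
- by move=> x y; rewrite row1_dist.
move=> r E r0 dE A [AE Ac _]; apply: ge_ereal_sup => _ [[x y] /= [Ax Ay] <-].
rewrite lee_fin; have [s [cs sA xs ys]] := Ac x y Ax Ay.
have [p [q [sp sq xy]]] := fK x y.
have [u us up] := chain_near_seg r0 cs xs ys sp.
have [v vs vq] := chain_near_seg r0 cs xs ys sq.
have uv : `|f u - f v| <= r.
  rewrite -row1_dist -lee_fin; apply: le_trans dE; apply: ereal_sup_ubound.
  exists (const_mx (f u) : euclidean R 1, const_mx (f v) : euclidean R 1) => //.
  by split; [exact: AE (sA _ us)|exact: AE (sA _ vs)].
have near w w' : mdist w w' <= C * r -> `|f w' - f w| <= L * C * r.
  by move=> ww'; rewrite distrC -mulrA (le_trans (fL _ _))// ler_pM2l.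
have := dist_perturb (near _ _ up) (near _ _ vq) => pq.
apply: le_trans xy _; rewrite -mulrA ler_pM2l//.
by apply: le_trans pq _; lra.
Qed.

End Light.

(** With r small against d(u, v), the only nonempty fibre, X itself, would have
    diameter less than d(u, v). *)
Lemma lipschitz_dim0 (R : realType) (X : metricType R) :
  connected [set: X] -> lipschitz_dim_le X 0 -> forall u v : X, u = v.
Proof.
move=> conX [f [L [Q [L0 Q0 _ light]]]] u v; apply: contrapT => /eqP uv.
have duv : 0 < mdist u v by rewrite mdist_gt0.
pose r := mdist u v / (2 * Q); have r0 : 0 < r by rewrite divr_gt0// mulr_gt0.
have dE : (diam [set: euclidean R 0] <= r%:E)%E.
  apply: ge_ereal_sup => _ [[x y] _ <-]; rewrite lee_fin.
  have -> : mdist x y = 0.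
    by change (euclid_dist x y = 0); rewrite /euclid_dist big_ord0 sqrtr0.
  exact: ltW.
have comp : delta_component r (f @^-1` setT) setT.
  split=> //; first exact: connected_delta.
  by move=> U _ _ TU; apply/seteqP; split.
have := light r setT r0 dE setT comp.
have : ((mdist u v)%:E <= diam [set: X])%E.
  by apply: ereal_sup_ubound; exists (u, v).
move=> /le_trans H /H; rewrite lee_fin /r leNgt => /negP; apply.
have -> : Q * (mdist u v / (2 * Q)) = mdist u v / 2 by field; rewrite gt_eqF.
lra.
Qed.

Theorem theorem4 (R : realType) (X : metricType R) :
  qc_tree X -> lipschitz_dim_eq X 1%N.
Proof.
move=> [[cX conX _ arcX] [u [v uv]] dX bX]; split; last first.
  by move=> [|//] /(lipschitz_dim0 conX)/(_ u v).
have [C C0 rhoC] := rho_le_mdist cX arcX dX bX.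
have [f [fL fK]] := oscillating_function cX arcX C0 rhoC u.
exists (fun x => const_mx (f x)).
apply: (oscillating_light cX arcX C0 rhoC _ _ fL fK) => //.
by rewrite mulr_gt0.
Qed.
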